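(* Let $f_0$ be a probability density on $\mathbb{R}^+=[0,\infty)$ whose cumulative distribution function $F(z,0)=\int_0^z f_0(y)\,dy$ has a Pareto tail: there are constants $k,\theta>0$ with $$\lim_{z\to\infty}\frac{1-F(z,0)}{z^{-1/\theta}}=k.$$ Let $r>0$ and let the learning function be constant, $\alpha=\alpha_0>0$. Then there exists a unique balanced growth path solution $(\Phi,v,0)$ (that is, with $\sigma=0$) and a scaling constant $\gamma$ of the system $$-\gamma\phi(x)-\gamma\phi'(x)x=\phi(x)\int_0^x\alpha(\sigma(y))\phi(y)\,dy-\alpha(\sigma(x))\phi(x)\int_x^\infty\phi(y)\,dy,$$ $$(r-\gamma)v(x)+\gamma v'(x)x=\max_{\sigma\in\Xi}\Big\{(1-\sigma)x+\alpha(\sigma)\int_x^\infty[v(y)-v(x)]\phi(y)\,dy\Big\},$$ where $\Phi(x)=\int_0^x\phi(y)\,dy$, and they are given by $$\gamma=\alpha_0\,\theta\int_{\mathbb{R}^+}f_0(z)\,dz,\qquad \Phi(x)=\frac{1}{1+kx^{-1/\theta}}.$$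
   Context: $\Xi=\{\sigma:\mathbb{R}^+\to[0,1]\}$ is the set of admissible controls, the maximum being taken pointwise in $x$; $\sigma$ denotes the maximizer. A balanced growth path solution is a triple $(\phi,v,\sigma)$ (equivalently $(\Phi,v,\sigma)$) solving, for a constant $\gamma$, the rescaled system $$-\gamma\phi(x)-\gamma\phi'(x)x=\phi(x)\int_0^x\alpha(\sigma(y))\phi(y)\,dy-\alpha(\sigma(x))\phi(x)\int_x^\infty\phi(y)\,dy,$$ $$(r-\gamma)v(x)+\gamma v'(x)x=\max_{\sigma\in\Xi}\Big\{(1-\sigma)x+\alpha(\sigma)\int_x^\infty[v(y)-v(x)]\phi(y)\,dy\Big\};$$ it corresponds to a solution of the original (unscaled) model for the agent density $f$, value function $V$ and control $s$ via $f(z,t)=e^{-\gamma t}\phi(ze^{-\gamma t})$, $V(z,t)=e^{\gamma t}v(ze^{-\gamma t})$, $s(z,t)=\sigma(ze^{-\gamma t})$. In particular $\int_0^\infty\phi\,dy=\int_0^\infty f_0\,dz$, and the Pareto tail assumption in the rescaled variable is $\lim_{z\to\infty}\frac{\int_z^\infty\phi(y)\,dy}{z^{-1/\theta}}=k$, with the same $k,\theta$.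
   Formalization: Existence of v is claimed only for θ<1 and r≠γ: for θ≥1 the integral in the v-equation diverges, and for r=γ the v-equation at x=0 is contradictory. σ=0 is shown unique only for x>0, since σ(0) does not affect the payoff; v is taken continuous on [0,∞). *)

(* Defs.v *)
From HB Require Import structures.
From mathcomp Require Import all_boot all_order all_algebra.
From mathcomp Require Import all_classical all_reals all_analysis.

Set Implicit Arguments.
Unset Strict Implicit.
Unset Printing Implicit Defensive.

Import Order.TTheory GRing.Theory Num.Theory.
Import numFieldNormedType.Exports.

Local Open Scope classical_set_scope.
Local Open Scope ring_scope.

(* Functions on R^+ = [0, +oo) are represented by functions R -> R; no
   definition below depends on their values at negative arguments. *)

Notation Rplus R := (`[(0 : R), +oo[%classic).

Section balanced_growth_path.
Context {R : realType}.
Local Notation mu := (@lebesgue_measure R).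

Implicit Types (f phi v sigma tau alpha : R -> R) (k theta r gamma x : R).

Definition is_probability_density f : Prop :=
  [/\ mu.-integrable (Rplus R) (EFin \o f),
      (forall x, 0 <= x -> 0 <= f x) &
      \int[mu]_(y in Rplus R) f y = 1].

Definition distribution_function f x : R := \int[mu]_(y in `[0, x]) f y.

Definition tail_mass f x : R := \int[mu]_(y in `[x, +oo[) f y.

Definition admissible : set (R -> R) :=
  [set sigma | forall x, 0 <= x -> 0 <= sigma x <= 1].

(* The rescaled agent distribution.  The equation is imposed on (0, +oo):
   solutions need not be differentiable, nor even bounded, at 0. *)
Record bgp_density alpha f0 k theta gamma phi sigma : Prop := {
  density_ge0 : forall x, 0 <= x -> 0 <= phi x ;
  density_integrable : mu.-integrable (Rplus R) (EFin \o phi) ;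
  density_mass : \int[mu]_(y in Rplus R) phi y = \int[mu]_(z in Rplus R) f0 z ;
  density_tail : tail_mass phi z / z `^ (- theta^-1) @[z --> +oo] --> k ;
  density_derivable : forall x, 0 < x -> derivable phi x 1 ;
  density_learning_integrable :
    mu.-integrable (Rplus R) (EFin \o (fun y => alpha (sigma y) * phi y)) ;
  density_eq : forall x, 0 < x ->
    - gamma * phi x - gamma * derive1 phi x * x =
    phi x * \int[mu]_(y in `[0, x]) (alpha (sigma y) * phi y)
    - alpha (sigma x) * phi x * tail_mass phi x }.

Definition payoff alpha phi v tau x : R :=
  (1 - tau x) * x
  + alpha (tau x) * \int[mu]_(y in `[x, +oo[) ((v y - v x) * phi y).

(* Pointwise maximum over the admissible controls, attained at sigma.
   In value_eq at x = 0 the term in derive1 v vanishes, so that no differentiability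
   of v is needed there. *)
Record bgp_value alpha r gamma phi v sigma : Prop := {
  value_continuous : {within Rplus R, continuous v} ;
  value_derivable : forall x, 0 < x -> derivable v x 1 ;
  value_integrable : forall x, 0 <= x ->
    mu.-integrable `[x, +oo[ (EFin \o (fun y => (v y - v x) * phi y)) ;
  value_maximizer : forall x tau, 0 <= x -> admissible tau ->
    payoff alpha phi v tau x <= payoff alpha phi v sigma x ;
  value_eq : forall x, 0 <= x ->
    (r - gamma) * v x + gamma * derive1 v x * x = payoff alpha phi v sigma x }.

Definition is_bgp alpha f0 k theta r gamma phi v sigma : Prop :=
  [/\ admissible sigma,
      bgp_density alpha f0 k theta gamma phi sigma &
      bgp_value alpha r gamma phi v sigma].

End balanced_growth_path.

(* Main.v *)
Require Import Defs.
From HB Require Import structures.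
From mathcomp Require Import all_boot all_order all_algebra.
From mathcomp Require Import all_classical all_reals all_analysis.
From mathcomp Require Import measurable_realfun ring lra.

Import Order.TTheory GRing.Theory Num.Theory.
Import numFieldNormedType.Exports.

Local Open Scope classical_set_scope.
Local Open Scope ring_scope.

(** Write [a] for the constant learning rate, [b = 1 / theta], [T] for the tail
    mass of a stationary density [phi] and [Phi = 1 - T] for its distribution
    function; the total mass is 1 because [f0] is a probability density.

    The density.  With a constant rate the density equation is the derivative
    of the identity [gamma x phi - a Phi T = c] ([density_first_integral]).
    Since [T] tends to 0, [x phi] tends to [c / gamma] at infinity, and a
    nonzero limit would give a mass growing like a logarithm; hence [c = 0]
    and [gamma x phi = a Phi T] ([density_first_order]).  This is the logistic
    equation in the variable [ln x]: the odds [Phi / T] are a constant multiple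
    of [x^(a / gamma)].  The Pareto tail then forces [a / gamma = b] and fixes
    the constant to [1 / k] ([stationary_density_unique]).  Conversely
    [Phi = x^b / (x^b + k)] satisfies all the requirements
    ([tailed_density_is_bgp]).

    The control.  When the learning rate does not depend on effort, effort
    costs income and brings nothing, so it vanishes ([bgp_control0]).

    The value function.  Differentiating the value equation removes the
    integral and leaves [gamma x v'' + (r + a T) v' = 1].  As
    [a T = gamma x phi / Phi], the function [x^rho Phi], with
    [rho = r / gamma], is an integrating factor:
    [(x^rho Phi v')' = x^(rho - 1) Phi / gamma] ([is_derive_scaled_marginal]).
    For two solutions with difference [d] this gives [x^rho Phi d' = C].
    A constant [C > 0] is impossible ([scaled_marginal_le]): because
    [1 / Phi >= k x^(-b)], either [rho + b >= 1] and [d] is unbounded at 0, or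
    [rho + b < 1] and the difference of the two learning gains, which is
    nonnegative, decreases at least like a multiple of [- ln x].  So [d] is
    constant, and the value equation reads [(r - gamma) d = 0].  Finally
    [r = gamma] admits no solution: [v] would be increasing, while the value
    equation at 0 would say that the learning gain at 0 vanishes
    ([bgp_rate_neq]).

    Existence of [v].  Integrating the linear equation from 0 yields a
    candidate for [v'] with values in [[0, 1 / r]] ([marginal_value_bounds]).
    Its primitive grows at most linearly, so it is integrable against [phi]
    when [theta < 1].  The value equation at 0 determines [v 0] when
    [r <> gamma], and it propagates to all [x] because the residual of the
    equation is constant on [x > 0] and of order [x] at 0
    ([bgp_value_fun_is_bgp]). *)

(** * Monotonicity and logarithmic growth *)

Section half_line_calculus.
Set Implicit Arguments.
Unset Strict Implicit.
Context {R : realType}.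
Implicit Types (f df F h : R -> R) (x y m : R).

Lemma is_derive_continuous f x (l : R) : is_derive x 1 f l -> {for x, continuous f}.
Proof. by move=> fx; apply: differentiable_continuous; exact/derivable1_diffP. Qed.

Lemma is_derive1E f x (l : R) : is_derive x 1 f l -> derive1 f x = l.
Proof. by move=> fx; rewrite derive1E derive_val. Qed.

Lemma derivable1_is_derive f x : derivable f x 1 -> is_derive x 1 f (derive1 f x).
Proof. by rewrite derive1E; exact: derivableP. Qed.

Lemma derive_ge0_le f df x y : x <= y ->
  (forall t : R, x <= t <= y -> is_derive t 1 f (df t)) ->
  (forall t : R, x <= t <= y -> 0 <= df t) -> f x <= f y.
Proof.
move=> xy fdf df0.
have [| |t] := @MVT_segment R f df x y xy.
- move=> t; rewrite in_itv/= => /andP[/ltW xt /ltW ty].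
  by apply: fdf; rewrite xt.
- apply: derivable_within_continuous => t; rewrite in_itv/= => txy.
  by have := fdf _ txy.
- rewrite in_itv/= => txy ft; rewrite -subr_ge0 ft mulr_ge0 ?subr_ge0//.
  exact: df0.
Qed.

Lemma derive0_const f x y : 0 < x -> 0 < y ->
  (forall t : R, 0 < t -> is_derive t 1 f 0) -> f x = f y.
Proof.
wlog xy : x y / x <= y.
  by move=> H x0 y0 f0; case: (leP x y) => [|/ltW] xy; [|symmetry]; apply: H.
move=> x0 y0 f0.
have tp (t : R) : x <= t <= y -> is_derive t 1 f 0.
  by case/andP => xt _; apply: f0; exact: lt_le_trans xt.
apply/eqP; rewrite eq_le (derive_ge0_le xy tp)//= -lerN2.
apply: (@derive_ge0_le (fun t => - f t) (fun=> - 0)) => // t txy.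
by apply: is_deriveN; exact: tp.
Qed.

(** Comparison of [f] with [m ln]: a lower bound on [t f'(t)] is a lower bound
    on the derivative of [f] with respect to [ln t].  Each divergence argument
    below rests on this estimate. *)
Lemma log_growth f df m x y : 0 < x -> x <= y ->
  (forall t : R, x <= t <= y -> is_derive t 1 f (df t)) ->
  (forall t : R, x <= t <= y -> m <= t * df t) ->
  m * (ln y - ln x) <= f y - f x.
Proof.
move=> x0 xy fdf mdf.
have tp (t : R) : x <= t <= y -> 0 < t by case/andP => xt _; exact: lt_le_trans xt.
suff: f x - m * ln x <= f y - m * ln y by lra.
apply: (@derive_ge0_le (fun t => f t - m * ln t) (fun t => df t - m * t^-1)) => // t txy.
- have ft := fdf t txy; have lt := is_derive1_ln (tp t txy).
  exact: is_derive_eq.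
- rewrite subr_ge0 -(ler_pM2l (tp t txy)) mulrCA mulfV ?mulr1 ?mdf//.
  exact/lt0r_neq0/tp.
Qed.

Lemma log_unbounded_pinfty f df m x : 0 < x -> 0 < m ->
  (forall t : R, x <= t -> is_derive t 1 f (df t)) ->
  (forall t : R, x <= t -> m <= t * df t) ->
  forall M, exists2 y, x <= y & M < f y.
Proof.
move=> x0 m0 fdf mdf M.
(* [c] solves [f x + m c > M]; the point [x e^c] is at logarithmic distance [c]. *)
pose c := (`|M - f x| + 1) / m.
have mc : m * c = `|M - f x| + 1 by rewrite mulrC divfK ?lt0r_neq0.
have c0 : 0 <= c by rewrite divr_ge0 ?(ltW m0)// addr_ge0.
have xy : x <= x * expR c by rewrite ler_peMr ?(ltW x0)// -expR0 ler_expR.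
exists (x * expR c) => //.
have := log_growth (y := x * expR c) (f := f) (df := df) (m := m) x0 xy.
rewrite lnM ?posrE ?expR_gt0// expRK addrAC subrr add0r.
rewrite mc => /(_ (fun t H => fdf t (andP H).1) (fun t H => mdf t (andP H).1)).
by have := ler_norm (M - f x); lra.
Qed.

Lemma log_unbounded_at_0 f df m x : 0 < x -> 0 < m ->
  (forall t : R, 0 < t <= x -> is_derive t 1 f (df t)) ->
  (forall t : R, 0 < t <= x -> m <= t * df t) ->
  forall M, exists2 y, 0 < y <= x & f y < M.
Proof.
move=> x0 m0 fdf mdf M.
pose c := (`|f x - M| + 1) / m.
have mc : m * c = `|f x - M| + 1 by rewrite mulrC divfK ?lt0r_neq0.
have c0 : 0 <= c by rewrite divr_ge0 ?(ltW m0)// addr_ge0.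
have y0 : 0 < x * expR (- c) by rewrite mulr_gt0 ?expR_gt0.
have yx : x * expR (- c) <= x.
  by rewrite ler_piMr ?(ltW x0)// -[leRHS]expR0 ler_expR oppr_le0.
exists (x * expR (- c)); first by rewrite y0.
have tp (t : R) : x * expR (- c) <= t <= x -> 0 < t <= x.
  by move=> /andP[yt ->]; rewrite (lt_le_trans y0).
have := log_growth (f := f) (df := df) (m := m) y0 yx
  (fun t H => fdf t (tp t H)) (fun t H => mdf t (tp t H)).
rewrite lnM ?posrE ?expR_gt0// expRK opprD addrA subrr add0r opprK mc.
by have := ler_norm (f x - M); lra.
Qed.

End half_line_calculus.

(** * Integrals of functions continuous on the open half-line *)

Section half_line_integrals.
Set Implicit Arguments.
Unset Strict Implicit.
Context {R : realType}.
Local Notation mu := (@lebesgue_measure R).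
Implicit Types (f g F L : R -> R) (u x y l c : R) (b : itv_bound R).

(** The functions met below may be singular at 0, where their value is
    arbitrary; one point does not affect measurability. *)
Lemma measurable_fun_half_line f b :
  (forall x, 0 < x -> {for x, continuous f}) ->
  measurable_fun [set` Interval (BLeft 0) b] f.
Proof.
move=> cf; have mf : measurable_fun (Rplus R) f.
  apply/measurable_fun_itv_obnd_cbndP; apply: open_continuous_measurable_fun => //.
  by move=> x; rewrite inE/= in_itv/= andbT; exact: cf.
by apply: measurable_funS mf => //; apply: subset_itvl => //; case: b => [[]|[]].
Qed.

Lemma integrable_scale (D : set R) c f : measurable D ->
  mu.-integrable D (EFin \o f) -> mu.-integrable D (EFin \o (fun x => c * f x)).
Proof.
move=> mD intf.
have -> : EFin \o (fun x => c * f x) = (fun x => c%:E * (EFin \o f) x)%E.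
  by apply/funext => x; rewrite /= EFinM.
exact: integrableZl.
Qed.

Lemma integrable_dominated (D : set R) f g : measurable D -> measurable_fun D f ->
  (forall x, D x -> `|f x| <= g x) ->
  mu.-integrable D (EFin \o g) -> mu.-integrable D (EFin \o f).
Proof.
move=> mD mf fg; apply: le_integrable => //; first exact/measurable_EFinP.
by move=> x Dx; rewrite lee_fin (le_trans (fg x Dx))// ler_norm.
Qed.

Lemma integrable_bounded f u c : (forall x, 0 < x -> {for x, continuous f}) ->
  (forall x, 0 <= x -> `|f x| <= c) -> mu.-integrable `[0, u] (EFin \o f).
Proof.
move=> cf fc; apply: (@integrable_dominated _ _ (fun=> c)) => //.
- exact: measurable_fun_half_line.
- by move=> x; rewrite /= in_itv/= => /andP[x0 _]; exact: fc.
- apply/integrableP; split; first exact/measurable_EFinP.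
  rewrite (eq_integral (cst `|c|%:E))// integral_cst//= lebesgue_measure_itv/=.
  case: ifP => _; first by rewrite -EFinB -EFinM ltry.
  by rewrite mule0 ltry.
Qed.

(** Monotone convergence along the intervals that start at [u / (n + 1)].  It
    extends antiderivative formulas to integrands that blow up at 0, which the
    stationary density does when [theta > 1]. *)
Lemma integral_improper_at_0 f L l b u : 0 < u ->
  (forall x, 0 < x -> {for x, continuous f}) -> (forall x, 0 < x -> 0 <= f x) ->
  (forall x, 0 < x <= u ->
     (\int[mu]_(y in [set` Interval (BLeft x) b]) (f y)%:E = (L x)%:E)%E) ->
  L x @[x --> 0^'+] --> l ->
  (\int[mu]_(y in [set` Interval (BLeft 0%R) b]) (f y)%:E = l%:E)%E.
Proof.
move=> u0 cf f0 fL Ll.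
have mf := @measurable_fun_half_line _ b cf.
pose E (n : nat) : set R := [set` Interval (BLeft (u / n.+1%:R)) b].
have un n : 0 < u / n.+1%:R by rewrite divr_gt0.
have mfo : measurable_fun [set` Interval (BRight 0) b] f.
  exact/measurable_fun_itv_obnd_cbndP.
rewrite -integral_itv_obnd_cbnd; last exact/measurable_EFinP.
have -> : [set` Interval (BRight 0) b] = \bigcup_n E n.
  apply/seteqP; split=> y /=.
    rewrite in_itv/= => /andP[y0 yb].
    have [n _ /(_ n (leqnn n))] := near_infty_natSinv_lt (PosNum (divr_gt0 y0 u0)).
    rewrite /= => ny; exists n => //; rewrite /E/= in_itv/= yb andbT.
    by rewrite mulrC -ler_pdivlMr// ltW.
  move=> [n _]; rewrite /E/= !in_itv/= => /andP[ny ->]; rewrite andbT.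
  exact: lt_le_trans ny.
have Ecvg : (\int[mu]_(x in E n) (f x)%:E @[n --> \oo] -->
    \int[mu]_(x in \bigcup_n E n) (f x)%:E)%E.
  apply: ge0_nondecreasing_set_cvg_integral => //.
  - move=> m n mn; rewrite subsetEset; apply: subset_itvr; rewrite bnd_simp.
    by rewrite ler_pM2l// lef_pV2 ?posrE// ler_nat ltnS.
  - by move=> i; exact: measurable_itv.
  - move=> i; apply/measurable_EFinP; apply: measurable_funS mf => //.
    by apply: subset_itvr; rewrite bnd_simp ltW.
  - move=> i x; rewrite /E/= in_itv/= => /andP[ix _].
    by rewrite lee_fin f0// (lt_le_trans _ ix).
have EL n : (\int[mu]_(x in E n) (f x)%:E = (L (u / n.+1%:R))%:E)%E.
  by rewrite /E fL// un/= ler_piMr ?(ltW u0)// invf_le1 ?ler1n.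
move: Ecvg; rewrite (funext EL) => Ecvg; apply: (cvg_unique _ Ecvg) => //.
apply: cvg_EFin; first exact: nearW.
move/cvg_at_rightP : Ll; apply; split => //.
rewrite -[X in _ --> X](mulr0 u); apply: cvgMr.
exact: cvg_harmonic.
Qed.

Lemma integrable_ge0_fin f l b :
  (forall x, 0 < x -> {for x, continuous f}) -> (forall x, 0 < x -> 0 <= f x) ->
  (\int[mu]_(y in [set` Interval (BLeft 0%R) b]) (f y)%:E = l%:E)%E ->
  mu.-integrable [set` Interval (BLeft 0) b] (EFin \o f).
Proof.
move=> cf f0 fl; have mf := @measurable_fun_half_line _ b cf.
apply/integrableP; split; first exact/measurable_EFinP.
have mfo g : measurable_fun [set` Interval (BLeft 0) b] g ->
    measurable_fun [set` Interval (BRight 0) b] (EFin \o g).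
  by move=> mg; apply/measurable_EFinP; apply/measurable_fun_itv_obnd_cbndP.
suff -> : (\int[mu]_(y in [set` Interval (BLeft 0%R) b]) `|(EFin \o f) y| = l%:E)%E.
  exact: ltry.
rewrite -fl -integral_itv_obnd_cbnd; last first.
  by apply: (mfo (Num.norm \o f)); exact: measurableT_comp.
rewrite -[RHS]integral_itv_obnd_cbnd; last exact: mfo.
apply: eq_integral => x; rewrite inE/= in_itv/= => /andP[x0 _].
by rewrite ger0_norm// f0.
Qed.

Lemma FTC_improper_segment f F u : 0 < u ->
  (forall x, 0 < x -> is_derive x 1 F (f x)) ->
  (forall x, 0 < x -> {for x, continuous f}) -> (forall x, 0 < x -> 0 <= f x) ->
  F x @[x --> 0^'+] --> 0 ->
  (\int[mu]_(y in `[0%R, u]) (f y)%:E = (F u)%:E)%E.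
Proof.
move=> u0 dF cf f0 F0.
apply: (@integral_improper_at_0 _ (fun x => F u - F x) _ _ u) => //; last first.
  by rewrite -[X in _ --> X]subr0; apply: cvgB => //; exact: cvg_cst.
move=> x /andP[x0]; rewrite le_eqVlt => /predU1P[->|xu].
  by rewrite set_itv1 integral_set1 subrr.
have pos y : x <= y -> 0 < y by exact: lt_le_trans.
rewrite (@continuous_FTC2 _ f F)//.
- apply: continuous_in_subspaceT => y; rewrite inE/= in_itv/= => /andP[/pos y0 _].
  exact: cf.
- split.
  + by move=> y; rewrite in_itv/= => /andP[/ltW /pos y0 _]; have := dF _ y0.
  + exact/cvg_at_right_filter/(is_derive_continuous (dF _ x0)).
  + exact/cvg_at_left_filter/(is_derive_continuous (dF _ u0)).
- by move=> y; rewrite in_itv/= => /andP[/ltW /pos y0 _]; exact: is_derive1E (dF _ y0).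
Qed.

Lemma FTC_tail f F l x : 0 < x ->
  (forall y, 0 < y -> is_derive y 1 F (f y)) ->
  (forall y, 0 < y -> {for y, continuous f}) -> (forall y, 0 < y -> 0 <= f y) ->
  F y @[y --> +oo] --> l ->
  (\int[mu]_(y in `[x, +oo[) (f y)%:E = (l - F x)%:E)%E.
Proof.
move=> x0 dF cf f0 Fl.
have pos y : x <= y -> 0 < y by exact: lt_le_trans.
rewrite EFinB; apply: ge0_continuous_FTC2y => //.
- by move=> y /pos; exact: f0.
- apply: continuous_in_subspaceT => y; rewrite inE/= in_itv/= andbT => /pos y0.
  exact: cf.
- by move=> y /ltW /pos y0; have := dF _ y0.
- exact/cvg_at_right_filter/(is_derive_continuous (dF _ x0)).
- by move=> y; rewrite in_itv/= andbT => /ltW /pos y0; exact: is_derive1E (dF _ y0).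
Qed.

Lemma is_derive_integral_head f x : 0 < x ->
  (forall u, mu.-integrable `[0, u] (EFin \o f)) -> {for x, continuous f} ->
  is_derive x 1 (fun x => \int[mu]_(y in `[0, x]) f y) (f x).
Proof.
move=> x0 intf cf.
have [||||d <-] := @continuous_FTC1 R f (BLeft 0) x (x + 1); rewrite ?ltrDl//.
exact: derivable1_is_derive.
Qed.

Lemma integral_head_tail f x : 0 <= x -> mu.-integrable (Rplus R) (EFin \o f) ->
  \int[mu]_(y in `[0, x]) f y + \int[mu]_(y in `[x, +oo[) f y =
  \int[mu]_(y in Rplus R) f y.
Proof.
move=> x0 intf.
rewrite -[X in _ + X]Rintegral_itv_obnd_cbnd; last first.
  by apply: integrableS intf => //; apply: subset_itvr; rewrite bnd_simp.
by rewrite -(@Rintegral_itvB _ _ (BLeft 0) +oo%O x)// addrC subrK.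
Qed.

(** Near [y] the tail is the constant integral over [x, +oo[ minus the integral
    over [x, y], to which the fundamental theorem of calculus applies. *)
Lemma is_derive_integral_tail f x y : x < y ->
  mu.-integrable `[x, +oo[ (EFin \o f) -> {for y, continuous f} ->
  is_derive y 1 (fun y => \int[mu]_(t in `[y, +oo[) f t) (- f y).
Proof.
move=> xy intf cf.
have dh : is_derive y 1 (fun y => \int[mu]_(t in `[x, y]) f t) (f y).
  have [||||d <-] := @continuous_FTC1 R f (BLeft x) y (y + 1); rewrite ?ltrDl//.
    by apply: integrableS intf => //; apply: subset_itvl.
  exact: derivable1_is_derive.
pose I := \int[mu]_(t in `[x, +oo[) f t.
apply: (@near_eq_is_derive _ _ _ (fun y => I - \int[mu]_(t in `[x, y]) f t)).
  near=> z; rewrite /I (@Rintegral_itvB _ _ (BLeft x) +oo%O z)//.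
    rewrite Rintegral_itv_obnd_cbnd//.
    apply: integrableS intf => //; apply: subset_itvr; rewrite bnd_simp ltW//.
    by near: z; exact: lt_nbhsr.
  by rewrite bnd_simp ltW//; near: z; exact: lt_nbhsr.
by apply: (is_derive_eq (is_deriveB (is_derive_cst I y 1) dh)); rewrite sub0r.
Unshelve. all: by end_near. Qed.

End half_line_integrals.

(** * The stationary distribution function *)

Section power_functions.
Set Implicit Arguments.
Unset Strict Implicit.
Context {R : realType}.
Implicit Types b c x : R.

Lemma is_derive_powR c x : 0 < x ->
  is_derive x 1 (fun x : R => x `^ c) (c * x `^ c / x).
Proof.
move=> x0; apply: (is_derive_eq (is_derive1_powR c x0)).
by rewrite powRB ?lt0r_neq0 ?implybT// powRr1 ?mulrA// ltW.
Qed.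

Lemma powRN_cvg_pinfty b : 0 < b -> x `^ (- b) @[x --> +oo] --> (0 : R).
Proof.
move=> b0; under eq_fun do rewrite powRN.
apply/gtr0_cvgV0.
  by near=> x; rewrite powR_gt0.
apply/cvgryPge => A.
near=> x; apply: le_trans (ler_norm A) _.
have Ax : `|A| `^ b^-1 <= x by near: x; exact: nbhs_pinfty_ge.
rewrite -[leLHS](powRr1 (normr_ge0 A)) -(mulVf (lt0r_neq0 b0)) powRrM.
apply: ge0_ler_powR => //; first exact: ltW.
- by rewrite nnegrE powR_ge0.
- by rewrite nnegrE (le_trans _ Ax)// powR_ge0.
Unshelve. all: by end_near. Qed.

End power_functions.

Section pareto_tailed_cdf.
Set Implicit Arguments.
Unset Strict Implicit.
Context {R : realType}.
Local Notation mu := (@lebesgue_measure R).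
Variables (k b : R).
Hypotheses (k0 : 0 < k) (b0 : 0 < b).
Implicit Types x y : R.

(** This agrees with [1 / (1 + k x^(- b))] for [x > 0]; the present form also has
    the right value at 0. *)
Definition tailed_cdf x : R := x `^ b / (x `^ b + k).
Local Notation P := tailed_cdf.

(** The derivative of the distribution function [P], written through the
    logistic equation [x P' = b P (1 - P)]. *)
Definition tailed_density x : R := b * (P x * (1 - P x)) / x.
Local Notation p := tailed_density.

Let den_gt0 x : 0 < x `^ b + k.
Proof. by rewrite ltr_wpDl// powR_ge0. Qed.

Lemma tailed_cdf_compl x : 1 - P x = k / (x `^ b + k).
Proof. by rewrite /P; field; exact: lt0r_neq0. Qed.

Lemma tailed_cdf_ge0 x : 0 <= P x.
Proof. by rewrite divr_ge0 ?powR_ge0// ltW. Qed.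

Lemma tailed_cdf_gt0 x : 0 < x -> 0 < P x.
Proof. by move=> x0; rewrite divr_gt0 ?powR_gt0. Qed.

Lemma tailed_cdf_lt1 x : 0 < 1 - P x.
Proof. by rewrite tailed_cdf_compl divr_gt0. Qed.

(** The odds [P / (1 - P)] are the power [x^b / k]: this is the property by which
    the distribution will be recognised. *)
Lemma tailed_cdf_odds x : 0 < x -> 1 - P x = k * x `^ (- b) * P x.
Proof.
move=> x0; rewrite tailed_cdf_compl powRN /P; field.
by rewrite !lt0r_neq0// powR_gt0.
Qed.

Lemma tailed_cdfE x : 0 < x -> P x = 1 / (1 + k * x `^ (- b)).
Proof.
move=> x0; have X0 := powR_gt0 b x0.
by rewrite /P powRN; field; rewrite !lt0r_neq0// addr_gt0.
Qed.

Lemma tailed_cdf_le x : P x <= x `^ b / k.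
Proof.
by rewrite ler_wpM2l ?powR_ge0// lef_pV2 ?posrE ?den_gt0// lerDr powR_ge0.
Qed.

Lemma tailed_density_ge0 x : 0 <= x -> 0 <= p x.
Proof.
move=> x0; rewrite /p divr_ge0// mulr_ge0 ?(ltW b0)// mulr_ge0 ?tailed_cdf_ge0//.
exact/ltW/tailed_cdf_lt1.
Qed.

Lemma is_derive_tailed_cdf x : 0 < x -> is_derive x 1 P (p x).
Proof.
move=> x0; have dX := is_derive_powR b x0.
have dD := is_deriveD dX (is_derive_cst k x 1).
have dV := @is_deriveV R (fun x => x `^ b + k) x _ 1 (lt0r_neq0 (den_gt0 x)) dD.
apply: (is_derive_eq (is_deriveM dX dV)).
rewrite /p tailed_cdf_compl /P /GRing.scale/=.
by field; rewrite !lt0r_neq0.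
Qed.

Lemma is_derive_tailed_density x : 0 < x ->
  is_derive x 1 p ((b * (1 - 2 * P x) - 1) * p x / x).
Proof.
move=> x0; have dP := is_derive_tailed_cdf x0.
have dQ := is_deriveB (is_derive_cst (1 : R) x 1) dP.
have dI := @is_deriveV R id x _ 1 (lt0r_neq0 x0) (is_derive_id x 1).
apply: (is_derive_eq (is_deriveM (is_deriveM (is_derive_cst b x 1) (is_deriveM dP dQ)) dI)).
rewrite /p !fctE /GRing.scale/=.
by field; rewrite lt0r_neq0.
Qed.

Lemma tailed_cdf_cvgy : P x @[x --> +oo] --> (1 : R).
Proof.
have X0 : x `^ (- b) @[x --> +oo] --> 0 by exact: powRN_cvg_pinfty.
have : (1 + k * x `^ (- b))^-1 @[x --> +oo] --> (1 + k * 0)^-1.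
  apply: cvgV; first by rewrite mulr0 addr0 oner_neq0.
  by apply: cvgD; [exact: cvg_cst | exact: cvgMr].
rewrite mulr0 addr0 invr1; apply: cvg_trans; apply: near_eq_cvg.
by near=> x; rewrite tailed_cdfE ?div1r.
Unshelve. all: by end_near. Qed.

Lemma tailed_cdf_cvg0 : P x @[x --> 0^'+] --> (0 : R).
Proof.
rewrite -[X in _ --> X](mul0r (0 + k)^-1).
apply: cvgM; first exact: powR_cvg0.
apply: cvgV; first by rewrite add0r lt0r_neq0.
by apply: cvgD; [exact: powR_cvg0 | exact: cvg_cst].
Qed.

Lemma continuous_tailed_density x : 0 < x -> {for x, continuous p}.
Proof. by move=> x0; exact: is_derive_continuous (is_derive_tailed_density x0). Qed.

Lemma integral_tailed_density :
  (\int[mu]_(y in Rplus R) (p y)%:E = 1%:E)%E.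
Proof.
apply: (@integral_improper_at_0 _ _ (fun x => 1 - P x) _ _ 1) => //.
- exact: continuous_tailed_density.
- by move=> x /ltW; exact: tailed_density_ge0.
- move=> x /andP[x0 _]; apply: FTC_tail => //.
  + exact: is_derive_tailed_cdf.
  + exact: continuous_tailed_density.
  + by move=> y /ltW; exact: tailed_density_ge0.
  + exact: tailed_cdf_cvgy.
- rewrite -[X in _ --> X]subr0; apply: cvgB; first exact: cvg_cst.
  exact: tailed_cdf_cvg0.
Qed.

Lemma integrable_tailed_density : mu.-integrable (Rplus R) (EFin \o p).
Proof.
apply: (integrable_ge0_fin _ _ integral_tailed_density).
- exact: continuous_tailed_density.
- by move=> x /ltW; exact: tailed_density_ge0.
Qed.

Lemma tail_mass_tailed_density x : 0 < x -> tail_mass p x = 1 - P x.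
Proof.
move=> x0; rewrite /tail_mass /Rintegral.
rewrite (FTC_tail x0 is_derive_tailed_cdf continuous_tailed_density _ tailed_cdf_cvgy)//.
by move=> y /ltW; exact: tailed_density_ge0.
Qed.

Lemma distribution_tailed_density x : 0 < x -> distribution_function p x = P x.
Proof.
move=> x0; have := integral_head_tail (ltW x0) integrable_tailed_density.
rewrite [X in _ + X]tail_mass_tailed_density// [RHS]/Rintegral integral_tailed_density/=.
by rewrite -/(distribution_function p x) => h; lra.
Qed.

End pareto_tailed_cdf.

(** * Stationary densities *)

Section stationary_density.
Set Implicit Arguments.
Unset Strict Implicit.
Context {R : realType}.
Local Notation mu := (@lebesgue_measure R).
Variables (f0 : R -> R) (k theta a : R).
Hypotheses (f0_mass : \int[mu]_(z in Rplus R) f0 z = 1).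
Hypotheses (k0 : 0 < k) (theta0 : 0 < theta) (a0 : 0 < a).
Local Notation b := theta^-1.
Local Notation P := (tailed_cdf k b).
Local Notation p := (tailed_density k b).
Implicit Types x y : R.

Let b0 : 0 < b. Proof. by rewrite invr_gt0. Qed.

Lemma tailed_density_is_bgp sigma :
  bgp_density (fun=> a) f0 k theta (a * theta) p sigma.
Proof.
have intp := integrable_tailed_density k0 b0.
split.
- by move=> x; exact: tailed_density_ge0.
- exact: intp.
- by rewrite f0_mass /Rintegral integral_tailed_density.
- have : (k * P z) @[z --> +oo] --> k * 1 by apply: cvgMr; exact: tailed_cdf_cvgy.
  rewrite mulr1; apply: cvg_trans; apply: near_eq_cvg; near=> z.
  have z0 : 0 < z by [].
  rewrite tail_mass_tailed_density// tailed_cdf_odds//.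
  by rewrite mulrAC mulfK// lt0r_neq0// powR_gt0.
- by move=> x x0; have := is_derive_tailed_density b k0 x0.
- exact: integrable_scale.
- move=> x x0; rewrite RintegralZl//; last first.
    by apply: integrableS intp => //; exact: subset_itvl.
  rewrite -/(distribution_function p x) distribution_tailed_density//.
  rewrite tail_mass_tailed_density// (is_derive1E (is_derive_tailed_density b k0 x0)).
  by rewrite /p; field; rewrite !lt0r_neq0.
Unshelve. all: by end_near. Qed.

Section uniqueness.
Variables (gamma : R) (phi sigma : R -> R).
Hypothesis bgp_phi : bgp_density (fun=> a) f0 k theta gamma phi sigma.
Local Notation T := (tail_mass phi).

Let derive_phi x : 0 < x -> is_derive x 1 phi (derive1 phi x).
Proof. by move=> x0; apply/derivable1_is_derive/(density_derivable bgp_phi). Qed.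

Let phi_ge0 x : 0 < x -> 0 <= phi x.
Proof. by move/ltW; exact: density_ge0 bgp_phi _. Qed.

Lemma is_derive_tail_mass x : 0 < x -> is_derive x 1 T (- phi x).
Proof.
move=> x0; apply: (is_derive_integral_tail x0 (density_integrable bgp_phi)).
exact: is_derive_continuous (derive_phi x0).
Qed.

Lemma distribution_tail x : 0 <= x -> distribution_function phi x = 1 - T x.
Proof.
move=> x0; have := integral_head_tail x0 (density_integrable bgp_phi).
rewrite (density_mass bgp_phi) f0_mass -/(T x) -/(distribution_function phi x) => <-.
by rewrite addrK.
Qed.

Lemma tail_mass_cvg0 : T x @[x --> +oo] --> (0 : R).
Proof.
have : T x / x `^ (- b) * x `^ (- b) @[x --> +oo] --> k * 0.
  by apply: cvgM; [exact: density_tail bgp_phi | exact: powRN_cvg_pinfty].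
rewrite mulr0; apply: cvg_trans; apply: near_eq_cvg; near=> x.
by rewrite divfK// lt0r_neq0// powR_gt0.
Unshelve. all: by end_near. Qed.

(** The limit [k] of the Pareto condition is positive, so [T] is positive at some
    larger point, and [T] is nonincreasing. *)
Lemma tail_mass_gt0 x : 0 < x -> 0 < T x.
Proof.
move=> x0.
have : \forall y \near +oo, 0 < T y / y `^ (- b).
  exact: (cvgr_gt k (density_tail bgp_phi) 0 k0).
move=> nT; near (pinfty_nbhs R) => y.
have xy : x <= y by near: y; apply: nbhs_pinfty_ge; exact: num_real.
have Ty : 0 < T y.
  have : 0 < T y / y `^ (- b) by near: y.
  by rewrite pmulr_lgt0// invr_gt0 powR_gt0// (lt_le_trans x0).
apply: (lt_le_trans Ty); rewrite -lerN2.
apply: (@derive_ge0_le _ (fun y => - T y) phi) => // t /andP[xt _].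
- have t0 := lt_le_trans x0 xt.
  by apply: (is_derive_eq (is_deriveN (is_derive_tail_mass t0))); rewrite opprK.
- exact: phi_ge0 (lt_le_trans x0 xt).
Unshelve. all: by end_near. Qed.

(** The derivative of this expression is the difference of the two sides of the
    density equation. *)
Lemma density_first_integral x y : 0 < x -> 0 < y ->
  gamma * x * phi x - a * ((1 - T x) * T x) =
  gamma * y * phi y - a * ((1 - T y) * T y).
Proof.
pose f z := gamma * z * phi z - a * ((1 - T z) * T z).
move=> x0 y0; apply: (derive0_const (f := f) x0 y0) => t t0.
have dT := is_derive_tail_mass t0.
have dp := derive_phi t0.
have dl := is_deriveM (is_deriveM (is_derive_cst gamma t 1) (is_derive_id t 1)) dp.
have dF := is_deriveB (is_derive_cst (1 : R) t 1) dT.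
have dr := is_deriveM (is_derive_cst a t 1) (is_deriveM dF dT).
apply: (is_derive_eq (is_deriveB dl dr)).
have := density_eq bgp_phi t0.
rewrite RintegralZl//; last first.
  by apply: integrableS (density_integrable bgp_phi) => //; exact: subset_itvl.
rewrite -/(distribution_function phi t) distribution_tail ?(ltW t0)//.
rewrite !fctE /GRing.scale/=.
lra.
Qed.

Let cvg_compl_tail : (1 - T x) * T x @[x --> +oo] --> (0 : R).
Proof.
rewrite -[X in _ --> X](mulr0 (1 - 0)); apply: cvgM; last exact: tail_mass_cvg0.
by apply: cvgB; [exact: cvg_cst | exact: tail_mass_cvg0].
Qed.

(** If [gamma = 0], the first integral says that [(1 - T) T] is constant, hence
    equal to its limit 0 at infinity; as [T > 0], this forces [T = 1] everywhere,
    which contradicts that [T] tends to 0. *)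
Lemma growth_rate_neq0 : gamma != 0.
Proof.
apply/negP => /eqP g0.
have compl0 x : 0 < x -> 1 - T x = 0.
  move=> x0; suff : (1 - T x) * T x = 0.
    by move/eqP; rewrite mulf_eq0 (gt_eqF (tail_mass_gt0 x0)) orbF => /eqP.
  have cst_compl : \forall y \near +oo, (1 - T y) * T y = (1 - T x) * T x.
    near=> y; have y0 : 0 < y by [].
    have := density_first_integral x0 y0; rewrite g0 !mul0r !sub0r => /oppr_inj.
    by move/(mulfI (lt0r_neq0 a0)).
  have : (1 - T y) * T y @[y --> +oo] --> (1 - T x) * T x.
    by apply: cvg_near_cst.
  by move/(cvg_unique (@Rhausdorff R) cvg_compl_tail) => <-.
have : T y @[y --> +oo] --> (1 : R).
  apply: cvg_near_cst; near=> y.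
  by apply/eqP; rewrite eq_sym -subr_eq0 compl0.
move/(cvg_unique (@Rhausdorff R) tail_mass_cvg0) => /eqP.
by rewrite eq_sym oner_eq0.
Unshelve. all: by end_near. Qed.

(** The constant [c] of the first integral is 0.  At infinity [y phi(y)] tends to
    [c / gamma], which is nonnegative since [phi] is; a positive limit makes
    [- T] grow like a logarithm, although [- T <= 0]. *)
Lemma density_first_order x : 0 < x ->
  gamma * x * phi x = a * ((1 - T x) * T x).
Proof.
pose c := gamma * 1 * phi 1 - a * ((1 - T 1) * T 1).
have first_integral y : 0 < y -> y * phi y = (a * ((1 - T y) * T y) + c) / gamma.
  move=> y0; rewrite /c -(density_first_integral y0 ltr01).
  by field; exact: growth_rate_neq0.
have phi_lim : y * phi y @[y --> +oo] --> c / gamma.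
  have : (a * ((1 - T y) * T y) + c) / gamma @[y --> +oo] --> (a * 0 + c) / gamma.
    apply: cvgMl; apply: cvgD; last exact: cvg_cst.
    exact: cvgMr cvg_compl_tail.
  rewrite mulr0 add0r; apply: cvg_trans; apply: near_eq_cvg; near=> y.
  by rewrite first_integral.
have c_ge0 : 0 <= c / gamma.
  rewrite -(cvg_lim _ phi_lim)//; apply: limr_ge; first by apply/cvg_ex; exists (c / gamma).
  by near=> y; rewrite mulr_ge0 ?phi_ge0// ltW.
suff c0 : c = 0.
  move=> x0; have := density_first_integral x0 ltr01.
  by rewrite -/c c0 => /eqP; rewrite subr_eq0 => /eqP.
apply/eqP/negP => /negP c_neq0.
have m0 : 0 < c / gamma / 2.
  rewrite divr_gt0// lt_neqAle c_ge0 andbT eq_sym mulf_neq0// invr_neq0//.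
  exact: growth_rate_neq0.
have [M [_ phiM]] : \forall y \near +oo, c / gamma / 2 < y * phi y.
  by apply: (cvgr_gt _ phi_lim); lra.
pose X := Num.max M 0 + 1.
have X0 : 0 < X by rewrite ltr_wpDl// le_max lexx orbT.
have MX : M < X by rewrite (le_lt_trans (_ : M <= Num.max M 0))// ?le_max ?lexx// ltrDl.
have [|y y1|y Xy] := @log_unbounded_pinfty _ (fun y => - T y) phi _ X X0 m0 _ _ 0.
- move=> t Xt; have t0 := lt_le_trans X0 Xt.
  by apply: (is_derive_eq (is_deriveN (is_derive_tail_mass t0))); rewrite opprK.
- by apply/ltW/phiM; exact: lt_le_trans y1.
- by rewrite oppr_gt0 ltNge ltW// tail_mass_gt0// (lt_le_trans X0).
Unshelve. all: by end_near. Qed.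

(** The first order equation makes [x^(- q) (1 - T) / T], with [q = a / gamma],
    constant.  Combined with the Pareto tail, [C x^(q - b)] then tends to
    [1 / k]; since the limit is unchanged under [x -> 2 x], the exponent is 0,
    and so [C = 1 / k]. *)
Theorem stationary_density_unique :
  [/\ gamma = a * theta, forall x, 0 < x -> T x = 1 - P x &
      forall x, 0 < x -> phi x = p x].
Proof.
have g_neq0 := growth_rate_neq0.
pose q := a / gamma.
have odds_cst x y : 0 < x -> 0 < y ->
    x `^ (- q) * ((1 - T x) / T x) = y `^ (- q) * ((1 - T y) / T y).
  pose f z := z `^ (- q) * ((1 - T z) / T z).
  move=> x0 y0; apply: (derive0_const (f := f) x0 y0) => t t0.
  have dT := is_derive_tail_mass t0.
  have T0 := lt0r_neq0 (tail_mass_gt0 t0).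
  have dV := @is_deriveV R T t _ 1 T0 dT.
  have dQ := is_deriveM (is_deriveB (is_derive_cst (1 : R) t 1) dT) dV.
  apply: (is_derive_eq (is_deriveM (is_derive_powR (- q) t0) dQ)).
  have phiE : phi t = q * ((1 - T t) * T t) / t.
    rewrite /q (mulrAC a) -(density_first_order t0).
    by field; rewrite g_neq0 lt0r_neq0.
  rewrite !fctE /GRing.scale/= phiE.
  by field; rewrite T0 lt0r_neq0.
pose C := 1 `^ (- q) * ((1 - T 1) / T 1).
have complE x : 0 < x -> 1 - T x = C * x `^ q * T x.
  move=> x0; rewrite /C -(odds_cst x 1 x0 ltr01) powRN.
  field; rewrite lt0r_neq0 ?tail_mass_gt0//=.
  by rewrite lt0r_neq0// powR_gt0.
pose L x := C * x `^ (q - b).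
have L_lim : L x @[x --> +oo] --> k^-1.
  have : (1 - T x) / (T x / x `^ (- b)) @[x --> +oo] --> (1 - 0) / k.
    apply: cvgM; first by apply: cvgB; [exact: cvg_cst | exact: tail_mass_cvg0].
    by apply: cvgV; [exact: lt0r_neq0 | exact: density_tail bgp_phi].
  rewrite subr0 div1r; apply: cvg_trans; apply: near_eq_cvg; near=> x.
  have x0 : 0 < x by [].
  rewrite complE// /L powRB ?lt0r_neq0 ?implybT// powRN.
  have T0 := tail_mass_gt0 x0; have [Xq Xb] := (powR_gt0 q x0, powR_gt0 b x0).
  by field; rewrite !lt0r_neq0.
have L2_lim : L (2 * x) @[x --> +oo] --> k^-1.
  apply: (cvg_comp _ _ _ L_lim); apply/cvgryPge => A; near=> x.
  by rewrite mulrC -ler_pdivrMr//; near: x; apply: nbhs_pinfty_ge; exact: num_real.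
have q_eq : q = b.
  have : L (2 * x) @[x --> +oo] --> 2 `^ (q - b) * k^-1.
    have : 2 `^ (q - b) * L x @[x --> +oo] --> 2 `^ (q - b) * k^-1 by exact: cvgMr.
    apply: cvg_trans; apply: near_eq_cvg; near=> x.
    by rewrite /L powRM// mulrCA.
  move/(cvg_unique (@Rhausdorff R) L2_lim) => /esym/eqP.
  rewrite -[eqbRHS]mul1r (inj_eq (mulIf _)) ?invr_eq0 ?lt0r_neq0//.
  by rewrite powR_eq1 => /or3P[/eqP ?|?|/eqP ?]; lra.
have CE : C = k^-1.
  apply: (cvg_unique (@Rhausdorff R) _ L_lim); apply: cvg_near_cst; near=> x.
  by rewrite /L q_eq subrr powRr0 mulr1.
have TE x : 0 < x -> T x = 1 - P x.
  move=> x0; have := complE x x0; rewrite CE q_eq tailed_cdf_compl//.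
  have : 0 < x `^ b by rewrite powR_gt0.
  move: (x `^ b) (T x) => X t X0 h.
  have : t * (X + k) = k.
    by have := congr1 ( *%R k) h; rewrite !mulrA mulfV ?lt0r_neq0// mul1r; lra.
  by move/(canRL (mulfK (lt0r_neq0 (addr_gt0 X0 k0)))).
split=> // [|x x0].
  move: q_eq; rewrite /q => /(congr1 (fun z => z * gamma * theta)).
  by rewrite divfK// mulrAC mulVf ?lt0r_neq0// mul1r.
have := density_first_order x0; rewrite TE// subKr.
have aE : a = b * gamma by rewrite -q_eq /q divfK.
rewrite /tailed_density => h.
apply: (mulfI (mulf_neq0 g_neq0 (lt0r_neq0 x0))); rewrite h {1}aE.
by field; rewrite !lt0r_neq0.
Unshelve. all: by end_near. Qed.

End uniqueness.
End stationary_density.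

(** * Uniqueness of the control and of the value function *)

Section gain_from_learning.
Set Implicit Arguments.
Unset Strict Implicit.
Context {R : realType}.
Local Notation mu := (@lebesgue_measure R).
Implicit Types (phi v : R -> R) (x y : R).

Definition learning_gain phi v x : R :=
  \int[mu]_(y in `[x, +oo[) ((v y - v x) * phi y).

(** Written with the fixed reference [v y], [y = x / 2], instead of [v z], the
    gain at [z] is a tail integral minus [(v z - v y) T z]; the two terms in
    [phi] cancel and only the variation of [v] remains. *)
Lemma is_derive_learning_gain phi v x : 0 < x ->
  mu.-integrable (Rplus R) (EFin \o phi) -> {for x, continuous phi} ->
  (forall y, 0 <= y ->
    mu.-integrable `[y, +oo[ (EFin \o (fun z => (v z - v y) * phi z))) ->
  derivable v x 1 ->
  is_derive x 1 (learning_gain phi v) (- (derive1 v x * tail_mass phi x)).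
Proof.
move=> x0 intphi cphi intv dv.
have y0 : 0 < x / 2 by rewrite divr_gt0.
have yx : x / 2 < x by lra.
pose y := x / 2; pose h z := (v z - v y) * phi z.
have dv' : is_derive x 1 v (derive1 v x) by exact: derivable1_is_derive.
have cv := is_derive_continuous dv'.
have ch : {for x, continuous h}.
  by apply: cvgM => //; apply: cvgB => //; exact: cvg_cst.
have dh := is_derive_integral_tail yx (intv y (ltW y0)) ch.
have dT := is_derive_integral_tail x0 intphi cphi.
apply: (@near_eq_is_derive R R^o R^o (fun z : R => \int[mu]_(t in `[z, +oo[) h t -
    (v z - v y) * tail_mass phi z)); last first.
  apply: (is_derive_eq (is_deriveB dh (is_deriveM (is_deriveB dv' (is_derive_cst (v y) x 1)) dT))).
  by rewrite !fctE /GRing.scale/= /h /tail_mass; ring.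
near=> z.
have yz : y <= z by rewrite ltW//; near: z; exact: lt_nbhsr.
have sub_yz : `[z, +oo[ `<=` `[y, +oo[ by apply: subset_itvr; rewrite bnd_simp.
have intz : mu.-integrable `[z, +oo[ (EFin \o phi).
  apply: integrableS intphi => //; apply: subset_itvr; rewrite bnd_simp.
  by rewrite (le_trans _ yz)// ltW.
rewrite /tail_mass -RintegralZl// -RintegralB//.
- by apply: eq_Rintegral => t _; rewrite /h; ring.
- by apply: integrableS (intv y (ltW y0)).
- exact: integrable_scale.
Unshelve. all: by end_near. Qed.

Lemma learning_gain_ge0 phi v x : 0 < x ->
  (forall y, 0 < y -> 0 <= phi y) -> (forall y, 0 < y -> derivable v y 1) ->
  (forall y, 0 < y -> 0 <= derive1 v y) -> 0 <= learning_gain phi v x.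
Proof.
move=> x0 phi0 dv v0; apply: Rintegral_ge0 => y /=; rewrite in_itv/= andbT => xy.
have pos t : x <= t <= y -> 0 < t by case/andP => xt _; exact: lt_le_trans xt.
rewrite mulr_ge0 ?phi0 ?(lt_le_trans x0 xy)// subr_ge0.
apply: (derive_ge0_le xy (df := derive1 v)) => t /pos t0; last exact: v0.
exact/derivable1_is_derive/dv.
Qed.

End gain_from_learning.

Section value_function.
Set Implicit Arguments.
Unset Strict Implicit.
Context {R : realType}.
Local Notation mu := (@lebesgue_measure R).
Variables (f0 : R -> R) (k theta a r : R).
Hypotheses (f0_mass : \int[mu]_(z in Rplus R) f0 z = 1).
Hypotheses (k0 : 0 < k) (theta0 : 0 < theta) (a0 : 0 < a).
Local Notation gamma := (a * theta).
Local Notation b := theta^-1.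
Local Notation P := (tailed_cdf k b).
Local Notation p := (tailed_density k b).
Local Notation rho := (r / gamma).
Implicit Types (x y : R) (phi v sigma : R -> R).

Let b0 : 0 < b. Proof. by rewrite invr_gt0. Qed.
Let gamma0 : 0 < gamma. Proof. exact: mulr_gt0. Qed.

Local Notation bgp := (is_bgp (fun=> a) f0 k theta r gamma).

(** The derivative of the value function times the integrating factor of the
    linear equation that it satisfies. *)
Definition scaled_marginal v x : R := x `^ rho * P x * derive1 v x.

Section one_solution.
Variables (phi v sigma : R -> R).
Hypothesis bgp_v : bgp phi v sigma.
Local Notation I := (learning_gain phi v).

Let density_v : bgp_density (fun=> a) f0 k theta gamma phi sigma.
Proof. by case: bgp_v. Qed.

Let value_v : bgp_value (fun=> a) r gamma phi v sigma.
Proof. by case: bgp_v. Qed.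

Lemma bgp_phiE x : 0 < x -> phi x = p x.
Proof. by have [_ _] := stationary_density_unique f0_mass k0 theta0 a0 density_v; exact. Qed.

Lemma bgp_tailE x : 0 < x -> tail_mass phi x = 1 - P x.
Proof. by have [_ + _] := stationary_density_unique f0_mass k0 theta0 a0 density_v; exact. Qed.

(** Compare [sigma] with the control that is identically 0: the learning gain is
    the same and the forgone income [sigma x * x] is saved. *)
Lemma bgp_control0 x : 0 < x -> sigma x = 0.
Proof.
move=> x0; have [adm _ _] := bgp_v.
have [s0 _] := andP (adm x (ltW x0)).
have adm0 : admissible (fun=> 0 : R) by move=> y _ /=; rewrite lexx ler01.
have := value_maximizer value_v (ltW x0) adm0; rewrite /payoff => h.
apply/eqP; rewrite eq_le s0 andbT -(pmulr_lle0 _ x0); lra.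
Qed.

Lemma bgp_value_eq x : 0 <= x ->
  (r - gamma) * v x + gamma * derive1 v x * x = x + a * I x.
Proof.
move=> x0; rewrite (value_eq value_v x0) /payoff; congr (_ + _).
move: x0; rewrite le_eqVlt => /predU1P[<-|x0]; first by rewrite mulr0.
by rewrite bgp_control0// subr0 mul1r.
Qed.

Lemma bgp_is_derive_value x : 0 < x -> is_derive x 1 v (derive1 v x).
Proof. by move=> x0; apply/derivable1_is_derive/(value_derivable value_v). Qed.

Lemma bgp_is_derive_gain x : 0 < x -> is_derive x 1 I (- (derive1 v x * (1 - P x))).
Proof.
move=> x0; rewrite -bgp_tailE//; apply: is_derive_learning_gain => //.
- exact: density_integrable density_v.
- have dphi := derivable1_is_derive (density_derivable density_v x0).
  exact: is_derive_continuous dphi.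
- exact: value_integrable value_v.
- exact: value_derivable value_v _ x0.
Qed.

(** Near [x] the value equation expresses [v'] through [v] and the learning gain,
    so [v'] is itself differentiable.  The terms in [v'] of the derivative
    cancel by the choice of the weight [x^rho P x], as [x p = b P (1 - P)]. *)
Lemma is_derive_scaled_marginal x : 0 < x ->
  is_derive x 1 (scaled_marginal v) (x `^ rho * P x / (gamma * x)).
Proof.
move=> x0.
have marginalE z : 0 < z -> derive1 v z = (z + a * I z - (r - gamma) * v z) / (gamma * z).
  move=> z0; rewrite -bgp_value_eq ?(ltW z0)//.
  by field; rewrite !lt0r_neq0.
have dv := bgp_is_derive_value x0; have dI := bgp_is_derive_gain x0.
have dX := is_derive_powR rho x0; have dP := is_derive_tailed_cdf b k0 x0.
have dg := @is_deriveV R (fun z => gamma * z) x _ 1 (lt0r_neq0 (mulr_gt0 gamma0 x0))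
  (is_deriveM (is_derive_cst gamma x 1) (is_derive_id x 1)).
have dn := is_deriveB (is_deriveD (is_derive_id x 1) (is_deriveM (is_derive_cst a x 1) dI))
  (is_deriveM (is_derive_cst (r - gamma) x 1) dv).
apply: (@near_eq_is_derive R R^o R^o (fun z : R => z `^ rho * P z *
    ((z + a * I z - (r - gamma) * v z) / (gamma * z)))).
  near=> z; rewrite /scaled_marginal marginalE//.
  by near: z; exact: lt_nbhsr.
apply: (is_derive_eq (is_deriveM (is_deriveM dX dP) (is_deriveM dn dg))).
rewrite !fctE /GRing.scale/= -/gamma.
have := bgp_value_eq (ltW x0); rewrite /tailed_density => e.
have Ie : I x = ((r - gamma) * v x + gamma * derive1 v x * x - x) / a.
  by rewrite e; field; exact: lt0r_neq0.
rewrite Ie.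
by field; rewrite !lt0r_neq0.
Unshelve. all: by end_near. Qed.

Lemma bgp_value_bounded x : exists M, forall y, 0 <= y <= x -> `|v y| <= M.
Proof.
have [x0|x0] := leP 0 x; last first.
  by exists 0 => y /andP[y0 yx]; have := le_lt_trans yx x0; rewrite ltNge y0.
have cv : {within `[0, x], continuous v}.
  by apply: continuous_subspaceW (value_continuous value_v); exact: subset_itvl.
have [c _ vc] := EVT_max x0 cv; have [d _ vd] := EVT_min x0 cv.
exists (`|v c| + `|v d|) => y yx.
have {}vc : v y <= v c by apply: vc; rewrite in_itv.
have {}vd : v d <= v y by apply: vd; rewrite in_itv.
have := ler_norm (v c); have := ler_norm (- v d); rewrite normrN.
have := normr_ge0 (v c); have := normr_ge0 (v d).
by move=> *; rewrite ler_norml; apply/andP; split; lra.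
Qed.

(** When [r = gamma], [rho = 1] and [x P v'] is nondecreasing.  If it were
    negative at some point, then, as [P <= 1], [x v'] would be bounded away from
    0 by a negative constant near 0, and [v] would be unbounded there.  Hence
    [v' >= 0], the learning gain is nonnegative, and the value equation gives
    [gamma x v' >= x > 0]. *)
Lemma bgp_value_incr : r = gamma -> forall x, 0 < x -> 0 < derive1 v x.
Proof.
move=> rg.
have rho1 : rho = 1 by rewrite rg divff// lt0r_neq0.
have u_incr x y : 0 < x -> x <= y -> scaled_marginal v x <= scaled_marginal v y.
  move=> x0 xy; apply: (derive_ge0_le xy (df := fun t => t `^ rho * P t / (gamma * t))).
    by move=> t /andP[/(lt_le_trans x0) t0 _]; exact: is_derive_scaled_marginal.
  move=> t /andP[/(lt_le_trans x0) t0 _].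
  exact: ltW (divr_gt0 (mulr_gt0 (powR_gt0 _ t0) (tailed_cdf_gt0 b k0 t0)) (mulr_gt0 gamma0 t0)).
have v'_ge0 x : 0 < x -> 0 <= derive1 v x.
  move=> x0; have Px := tailed_cdf_gt0 b k0 x0.
  rewrite leNgt; apply/negP => v'0.
  have u0 : scaled_marginal v x < 0.
    by rewrite /scaled_marginal pmulr_rlt0// mulr_gt0 ?powR_gt0.
  have [M vM] := bgp_value_bounded x.
  have [|||y /andP[y0 yx]] := @log_unbounded_at_0 _ (fun y => - v y) (fun y => - derive1 v y)
      (- scaled_marginal v x) x x0 _ _ _ (- M).
  - by rewrite oppr_gt0.
  - by move=> t /andP[t0 _]; apply: is_deriveN; exact: bgp_is_derive_value.
  - move=> t /andP[t0 tx]; have := u_incr t x t0 tx.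
    have Pt := tailed_cdf_gt0 b k0 t0; have Pt1 := tailed_cdf_lt1 b k0 t.
    rewrite {1}/scaled_marginal rho1 powRr1 ?(ltW t0)// mulrAC => utx.
    have tv0 : t * derive1 v t < 0.
      by rewrite -(pmulr_llt0 _ Pt); exact: le_lt_trans u0.
    rewrite mulrN lerN2; apply: le_trans utx.
    by rewrite ler_nMr//; lra.
  - rewrite ltrN2 => Mv; have := vM y; rewrite yx (ltW y0) => /(_ isT).
    by have := ler_norm (v y); lra.
move=> x x0; have Ix : 0 <= I x.
  apply: learning_gain_ge0 => // y y0; first by rewrite bgp_phiE// tailed_density_ge0// ltW.
  exact: value_derivable value_v y y0.
have := bgp_value_eq (ltW x0); rewrite rg subrr mul0r add0r => e.
rewrite -(pmulr_rgt0 _ gamma0) -(pmulr_lgt0 _ x0) e ltr_pwDl//.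
by rewrite mulr_ge0// ltW.
Qed.

(** When [r = gamma] the value equation at 0 says that the integral of
    [(v - v 0) phi] is 0, whereas [v] is strictly increasing. *)
Lemma bgp_rate_neq : r != gamma.
Proof.
apply/negP => /eqP rg; have v'0 := bgp_value_incr rg.
have v_incr y : 0 < y -> v 0 < v y.
  move=> y0; have [||c] := @MVT R v (derive1 v) 0 y y0.
  - by move=> t; rewrite in_itv/= => /andP[t0 _]; exact: bgp_is_derive_value.
  - by apply: continuous_subspaceW (value_continuous value_v); exact: subset_itvl.
  rewrite in_itv/= subr0 => /andP[c0 _] e; rewrite -subr_gt0 e.
  by rewrite mulr_gt0// v'0.
have int0 := value_integrable value_v (lexx 0).
have I0 : I 0 = 0.
  have := bgp_value_eq (lexx 0); rewrite rg subrr mul0r mulr0 !add0r => /esym/eqP.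
  by rewrite mulf_eq0 (gt_eqF a0) => /eqP.
have := integral_head_tail ler01 int0; rewrite -/(I 0) I0.
have head0 : 0 <= \int[mu]_(y in `[0, 1]) ((v y - v 0) * phi y).
  apply: Rintegral_ge0 => y /=; rewrite in_itv/= => /andP[].
  rewrite le_eqVlt => /predU1P[<- _|y0 _]; first by rewrite subrr mul0r.
  by rewrite mulr_ge0 ?subr_ge0 ?(ltW (v_incr y y0))// bgp_phiE// tailed_density_ge0// ltW.
have tail0 : (v 1 - v 0) * tail_mass phi 1 <= \int[mu]_(y in `[1, +oo[) ((v y - v 0) * phi y).
  have sub1 : `[1, +oo[ `<=` Rplus R by apply: subset_itvr; rewrite bnd_simp.
  have int1 : mu.-integrable `[1, +oo[ (EFin \o phi).
    by apply: integrableS (density_integrable density_v).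
  rewrite /tail_mass -RintegralZl//; apply: le_Rintegral => //.
  - exact: integrable_scale.
  - exact: integrableS int0.
  - move=> y /=; rewrite in_itv/= andbT => y1.
    have y0 := lt_le_trans ltr01 y1.
    rewrite ler_wpM2r ?bgp_phiE ?tailed_density_ge0 ?(ltW y0)// lerD2r.
    apply: (derive_ge0_le y1 (df := derive1 v)) => t /andP[t1 _].
      exact: bgp_is_derive_value (lt_le_trans ltr01 t1).
    exact/ltW/v'0/(lt_le_trans ltr01 t1).
have gain_pos : 0 < (v 1 - v 0) * tail_mass phi 1.
  by rewrite mulr_gt0 ?subr_gt0 ?v_incr// bgp_tailE// tailed_cdf_lt1.
by move=> sum0; have := ltr_wpDl head0 (lt_le_trans gain_pos tail0); rewrite sum0 ltxx.
Qed.

End one_solution.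

Section two_solutions.
Variables (phi1 v1 sigma1 phi2 v2 sigma2 : R -> R).
Hypotheses (bgp1 : bgp phi1 v1 sigma1) (bgp2 : bgp phi2 v2 sigma2).

Lemma scaled_marginal_diff x y : 0 < x -> 0 < y ->
  scaled_marginal v1 x - scaled_marginal v2 x =
  scaled_marginal v1 y - scaled_marginal v2 y.
Proof.
move=> x0 y0.
apply: (derive0_const (f := fun x => scaled_marginal v1 x - scaled_marginal v2 x) x0 y0) => t t0.
have d1 := is_derive_scaled_marginal bgp1 t0.
have d2 := is_derive_scaled_marginal bgp2 t0.
by apply: (is_derive_eq (is_deriveB d1 d2)); rewrite subrr.
Qed.

(** Otherwise [d = v1 - v2] satisfies [x^rho P d' = C] with [C > 0].  As
    [P <= x^b / k], this gives [x d' >= C k x^(1 - rho - b)].  If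
    [rho + b >= 1], the right-hand side is at least [C k] on ]0, 1] and [d] is
    unbounded at 0.  If [rho + b < 1], the difference [J] of the learning gains
    has derivative [- d' (1 - P)], with [x d' (1 - P) = C k x^(1 - rho - b)] at
    least [C k] on [1, +oo[; so [J] tends to [- oo], although [J >= 0] because
    [d] is increasing. *)
Lemma scaled_marginal_le : scaled_marginal v1 1 <= scaled_marginal v2 1.
Proof.
rewrite -subr_le0; set C := _ - _; rewrite leNgt; apply/negP => C0.
pose dv x := derive1 v1 x - derive1 v2 x.
have dvE x : 0 < x -> x `^ rho * P x * dv x = C.
  by move=> x0; rewrite /C -(scaled_marginal_diff x0 ltr01) -mulrBr.
have is_dv x : 0 < x -> is_derive x 1 (fun x => v1 x - v2 x) (dv x).
  move=> x0; apply: is_deriveB; first exact: bgp_is_derive_value bgp1 _ x0.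
  exact: bgp_is_derive_value bgp2 _ x0.
have dv_gt0 x : 0 < x -> 0 < dv x.
  move=> x0; have : 0 < x `^ rho * P x * dv x by rewrite dvE.
  by rewrite pmulr_rgt0// mulr_gt0 ?powR_gt0 ?tailed_cdf_gt0.
have [p1|p1] := leP 1 (rho + b).
  have [M1 v1M] := bgp_value_bounded bgp1 1.
  have [M2 v2M] := bgp_value_bounded bgp2 1.
  have [|t /andP[t0 t1]|t /andP[t0 t1]|y /andP[y0 y1] vy] :=
    @log_unbounded_at_0 _ (fun x => v1 x - v2 x) dv (C * k) 1 ltr01 _ _ _ (- (M1 + M2)).
  - by rewrite mulr_gt0.
  - exact: is_dv.
  - have X0 := powR_gt0 rho t0.
    have tdv0 : 0 <= t * dv t by rewrite mulr_ge0// ltW// dv_gt0.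
    rewrite -(dvE t t0) mulrAC -[leRHS]mul1r -mulrA.
    have Pk : P t * k <= t `^ b by rewrite -ler_pdivlMr// tailed_cdf_le.
    have tp : t `^ rho * t `^ b <= t.
      rewrite -powRD ?(lt0r_neq0 t0) ?implybT//.
      by apply: ge1r_powR => //; rewrite t0.
    have : t `^ rho * (P t * k) * dv t <= t * dv t.
      rewrite ler_wpM2r ?(ltW (dv_gt0 t t0))//; apply: le_trans tp.
      by rewrite ler_wpM2l// ltW.
    by rewrite mul1r => h; apply: le_trans h; rewrite le_eqVlt; apply/orP; left; apply/eqP; ring.
  - have := v1M y; have := v2M y; rewrite (ltW y0) y1 => /(_ isT) + /(_ isT).
    by rewrite !ler_norml => /andP[_ ?] /andP[? _]; lra.
pose J x := learning_gain phi1 v1 x - learning_gain phi2 v2 x.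
have J_ge0 x : 0 < x -> 0 <= J x.
  move=> x0; rewrite subr_ge0; apply: le_Rintegral => //.
  - by case: bgp2 => _ _ /value_integrable; apply; exact: ltW.
  - by case: bgp1 => _ _ /value_integrable; apply; exact: ltW.
  - move=> y /=; rewrite in_itv/= andbT => xy; have y0 := lt_le_trans x0 xy.
    rewrite (bgp_phiE bgp1)// (bgp_phiE bgp2)// ler_wpM2r ?tailed_density_ge0 ?(ltW y0)//.
    suff : v1 x - v2 x <= v1 y - v2 y by lra.
    apply: (derive_ge0_le xy (f := fun x => v1 x - v2 x) (df := dv)) => t /andP[xt _].
      exact: is_dv (lt_le_trans x0 xt).
    exact/ltW/dv_gt0/(lt_le_trans x0 xt).
have [|t t1|t t1|y y1] := @log_unbounded_pinfty _ (fun x => - J x)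
  (fun x => dv x * (1 - P x)) (C * k) 1 ltr01 _ _ _ 0.
- by rewrite mulr_gt0.
- have t0 := lt_le_trans ltr01 t1.
  have d1 := bgp_is_derive_gain bgp1 t0; have d2 := bgp_is_derive_gain bgp2 t0.
  apply: (is_derive_eq (is_deriveN (is_deriveB d1 d2))).
  by rewrite /dv; ring.
- have t0 := lt_le_trans ltr01 t1.
  rewrite tailed_cdf_odds// -(dvE t t0) powRN.
  have Pt := tailed_cdf_gt0 b k0 t0; have X0 := powR_gt0 b t0.
  have -> : t * (dv t * (k / t `^ b * P t)) = t / t `^ b * (P t * dv t * k).
    by field; rewrite lt0r_neq0.
  have -> : t `^ rho * P t * dv t * k = t `^ rho * (P t * dv t * k) by ring.
  apply: ler_wpM2r.
    exact: mulr_ge0 (mulr_ge0 (ltW Pt) (ltW (dv_gt0 t t0))) (ltW k0).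
  rewrite ler_pdivlMr// -powRD ?(lt0r_neq0 t0) ?implybT//.
  by apply: ler1_powR => //; exact: ltW.
- by rewrite oppr_gt0 ltNge J_ge0// (lt_le_trans ltr01).
Qed.

End two_solutions.

(** The comparison of the scaled marginal values holds in both directions, so
    [v1 - v2] is constant and the learning gains coincide.  The value equations
    then differ by [(r - gamma) (v1 - v2) = 0], and [r] differs from [gamma]. *)
Theorem bgp_value_unique phi1 v1 sigma1 phi2 v2 sigma2 :
  bgp phi1 v1 sigma1 -> bgp phi2 v2 sigma2 -> forall x, 0 <= x -> v1 x = v2 x.
Proof.
move=> bgp1 bgp2.
have u12 : scaled_marginal v1 1 = scaled_marginal v2 1.
  by apply/eqP; rewrite eq_le (scaled_marginal_le bgp1 bgp2) (scaled_marginal_le bgp2 bgp1).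
have marginal_eq x : 0 < x -> derive1 v1 x = derive1 v2 x.
  move=> x0; have := scaled_marginal_diff bgp1 bgp2 x0 ltr01.
  rewrite u12 subrr /scaled_marginal -mulrBr => /eqP.
  rewrite mulf_eq0 (gt_eqF (mulr_gt0 (powR_gt0 rho x0) (tailed_cdf_gt0 b k0 x0))) /=.
  rewrite subr_eq0.
  by move/eqP.
have diff_cst x y : 0 < x -> 0 < y -> v1 x - v2 x = v1 y - v2 y.
  move=> x0 y0; apply: (derive0_const (f := fun x => v1 x - v2 x) x0 y0) => t t0.
  have d1 := bgp_is_derive_value bgp1 t0; have d2 := bgp_is_derive_value bgp2 t0.
  by apply: (is_derive_eq (is_deriveB d1 d2)); rewrite marginal_eq// subrr.
have pos x : 0 < x -> v1 x = v2 x.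
  move=> x0; have e1 := bgp_value_eq bgp1 (ltW x0).
  have e2 := bgp_value_eq bgp2 (ltW x0).
  have gain_eq : learning_gain phi1 v1 x = learning_gain phi2 v2 x.
    apply: eq_Rintegral => y; rewrite inE/= in_itv/= andbT => xy.
    have y0 := lt_le_trans x0 xy.
    rewrite (bgp_phiE bgp1)// (bgp_phiE bgp2)//; congr (_ * _).
    by have := diff_cst x y x0 y0; lra.
  have := bgp_rate_neq bgp1; rewrite -subr_eq0 => rg.
  apply: (mulfI rg); move: e1 e2; rewrite gain_eq marginal_eq//; lra.
move=> x; rewrite le_eqVlt => /predU1P[<-|]; last exact: pos.
case: bgp1 => _ _ /value_continuous/continuous_within_itvcyP[_ v1_0].
case: bgp2 => _ _ /value_continuous/continuous_within_itvcyP[_ v2_0].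
apply: (cvg_unique (@Rhausdorff R) v1_0); apply: cvg_trans v2_0.
apply: near_eq_cvg; near=> y; rewrite pos//.
Unshelve. all: by end_near. Qed.

End value_function.

(** * First moment of the stationary density *)

Section first_moment.
Set Implicit Arguments.
Unset Strict Implicit.
Context {R : realType}.
Local Notation mu := (@lebesgue_measure R).
Variables (k b : R).
Hypotheses (k0 : 0 < k) (b1 : 1 < b).
Local Notation P := (tailed_cdf k b).
Local Notation p := (tailed_density k b).
Implicit Types x y : R.

Let b0 : 0 < b. Proof. exact: lt_trans b1. Qed.

(** Up to a constant, this is the majorant of [x p(x)]: it decays like [x^(- b)],
    is bounded at 0, and has the elementary primitive [- (1 + y)^(1 - b)]. *)
Lemma integrable_shifted_power :
  mu.-integrable (Rplus R) (EFin \o (fun y => (b - 1) * (1 + y) `^ (- b))).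
Proof.
have pos x : 0 <= x -> 0 < 1 + x by move=> x0; rewrite ltr_wpDr.
have d1 x : is_derive x 1 (fun y : R => 1 + y) 1.
  apply: (is_derive_eq (is_deriveD (is_derive_cst (1 : R) x 1) (is_derive_id x 1))).
  by rewrite add0r.
have dF c x : 0 <= x -> is_derive x 1 (fun y => (1 + y) `^ c) (c * (1 + x) `^ (c - 1)).
  move=> x0; have dc := is_derive1_powR c (pos _ x0).
  have dcomp := is_derive1_comp (f := fun z : R => z `^ c) (g := fun y => 1 + y) dc (d1 x).
  by apply: (is_derive_eq dcomp); rewrite mulr1.
pose f y := (b - 1) * (1 + y) `^ (- b).
have cf x : 0 < x -> {for x, continuous f}.
  move=> /ltW x0.
  exact: is_derive_continuous (is_deriveM (is_derive_cst (b - 1) x 1) (dF (- b) x x0)).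
have f0 x : 0 < x -> 0 <= f x.
  by move=> x0; rewrite mulr_ge0 ?powR_ge0// subr_ge0 ltW.
pose F y := - (1 + y) `^ (1 - b).
have is_dF x : 0 <= x -> is_derive x 1 F (f x).
  move=> x0; apply: (is_derive_eq (is_deriveN (dF (1 - b) x x0))).
  by rewrite /f addrAC subrr add0r -mulNr opprB.
have Fy : F y @[y --> +oo] --> (0 : R).
  rewrite -[X in _ --> X]oppr0; apply: cvgN.
  rewrite -[1 - b]opprB.
  apply: (cvg_comp (fun y => 1 + y) (fun z => z `^ (- (b - 1)))); last first.
    by apply: powRN_cvg_pinfty; rewrite subr_gt0.
  apply/cvgryPge => A; near=> y.
  by rewrite -lerBlDl; near: y; apply: nbhs_pinfty_ge; exact: num_real.
apply: (@integrable_ge0_fin _ f (0 - F 0) +oo%O cf f0).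
apply: (@integral_improper_at_0 _ _ (fun x => 0 - F x) _ _ 1) => //.
- by move=> x /andP[x0 _]; apply: FTC_tail => // y /ltW; exact: is_dF.
- apply: cvgB; first exact: cvg_cst.
  exact/cvg_at_right_filter/(is_derive_continuous (is_dF 0 (lexx 0))).
Unshelve. all: by end_near. Qed.

Lemma tailed_cdf_compl_le x : 0 <= x ->
  1 - P x <= k * (2 `^ b * (1 + k^-1)) * (1 + x) `^ (- b).
Proof.
move=> x0; rewrite tailed_cdf_compl// -mulrA ler_pM2l// powRN.
have x1 : 0 < 1 + x by rewrite ltr_wpDr.
rewrite ler_pdivlMr ?powR_gt0// mulrC ler_pdivrMr ?ltr_wpDl ?powR_ge0//.
have X0 := powR_ge0 x b.
(* [(1 + x)^b <= 2^b max(1, x)^b]. *)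
apply: (@le_trans _ _ (2 `^ b * (1 + x `^ b))).
  have [x_le1|x_ge1] := leP x 1.
    apply: (@le_trans _ _ (2 `^ b)).
      by apply: ge0_ler_powR; rewrite ?nnegrE ?(ltW b0) ?(ltW x1)//; lra.
    by rewrite ler_peMr ?powR_ge0// lerDl.
  apply: (@le_trans _ _ ((2 * x) `^ b)).
    by apply: ge0_ler_powR; rewrite ?nnegrE ?(ltW b0) ?(ltW x1)//; lra.
  by rewrite powRM// ler_wpM2l ?powR_ge0// lerDr.
rewrite -mulrA ler_wpM2l ?powR_ge0//.
have -> : (1 + k^-1) * (x `^ b + k) = 1 + x `^ b + (k + x `^ b / k).
  by field; exact: lt0r_neq0.
by rewrite lerDl addr_ge0 ?divr_ge0 ?(ltW k0).
Qed.

(** [x p = b P (1 - P) <= b (1 - P)], and the survival function [1 - P] has a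
    tail of order [x^(- b)] with [b > 1]. *)
Lemma integrable_first_moment :
  mu.-integrable (Rplus R) (EFin \o (fun y => y * p y)).
Proof.
pose c := b * (k * (2 `^ b * (1 + k^-1))) / (b - 1).
apply: integrable_dominated (integrable_scale c _ integrable_shifted_power) => //.
  apply: measurable_fun_half_line => x x0.
  by apply: cvgM; [exact: cvg_id | exact: continuous_tailed_density].
move=> x; rewrite /= in_itv/= andbT => x0.
rewrite ger0_norm; last by rewrite mulr_ge0// tailed_density_ge0.
have -> : c * ((b - 1) * (1 + x) `^ (- b)) = b * (k * (2 `^ b * (1 + k^-1)) * (1 + x) `^ (- b)).
  by rewrite /c; field; rewrite subr_eq0 gt_eqF//= gt_eqF.
apply: (@le_trans _ _ (b * (1 - P x))); last first.
  by rewrite ler_pM2l// tailed_cdf_compl_le.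
have Tx := tailed_cdf_lt1 b k0 x; have Px := tailed_cdf_ge0 b k0 x.
have PTx : P x * (1 - P x) <= 1 - P x by rewrite ler_piMl//; lra.
move: x0; rewrite le_eqVlt => /predU1P[<-|x0].
  by rewrite mul0r mulr_ge0// ltW// tailed_cdf_lt1.
by rewrite /tailed_density mulrC divfK ?lt0r_neq0// ler_pM2l.
Qed.

End first_moment.

(** * Construction of a value function *)

Section value_construction.
Set Implicit Arguments.
Unset Strict Implicit.
Context {R : realType}.
Local Notation mu := (@lebesgue_measure R).
Variables (f0 : R -> R) (k theta a r : R).
Hypotheses (f0_mass : \int[mu]_(z in Rplus R) f0 z = 1).
Hypotheses (k0 : 0 < k) (theta0 : 0 < theta) (a0 : 0 < a) (r0 : 0 < r).
Local Notation gamma := (a * theta).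
Local Notation b := theta^-1.
Local Notation P := (tailed_cdf k b).
Local Notation p := (tailed_density k b).
Local Notation rho := (r / gamma).
Implicit Types x y u : R.

Let b0 : 0 < b. Proof. by rewrite invr_gt0. Qed.
Let gamma0 : 0 < gamma. Proof. exact: mulr_gt0. Qed.
Let rho0 : 0 < rho. Proof. exact: divr_gt0. Qed.

(** Up to the factor [1 / gamma], the right-hand side of
    [(x^rho P v')' = x^(rho - 1) P / gamma].  Its primitive that vanishes at 0
    selects the solution [v'] that is bounded at 0. *)
Definition marginal_source x : R := x `^ rho * P x / x.

Definition marginal_num x : R := \int[mu]_(y in `[0, x]) marginal_source y.

Definition marginal_value x : R := marginal_num x / (gamma * (x `^ rho * P x)).

Definition value_increment x : R := \int[mu]_(y in `[0, x]) marginal_value y.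

Local Notation n := marginal_source.
Local Notation N := marginal_num.
Local Notation w := marginal_value.
Local Notation V := value_increment.

Let weight_gt0 x : 0 < x -> 0 < x `^ rho * P x.
Proof. by move=> x0; exact: mulr_gt0 (powR_gt0 _ x0) (tailed_cdf_gt0 b k0 x0). Qed.

Let weight_ge0 x : 0 <= x `^ rho * P x.
Proof. exact: mulr_ge0 (powR_ge0 _ _) (tailed_cdf_ge0 b k0 x). Qed.

Let is_derive_weight x : 0 < x ->
  is_derive x 1 (fun x => x `^ rho * P x) (rho * n x + x `^ rho * p x).
Proof.
move=> x0; have dX := is_derive_powR rho x0.
have dP := is_derive_tailed_cdf b k0 x0.
apply: (is_derive_eq (is_deriveM dX dP)); rewrite /n /GRing.scale/=.
by ring.
Qed.

Let source_ge0 x : 0 <= x -> 0 <= n x.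
Proof. by move=> x0; rewrite divr_ge0. Qed.

Let continuous_source x : 0 < x -> {for x, continuous n}.
Proof.
move=> x0; apply: cvgM; first exact: is_derive_continuous (is_derive_weight x0).
by apply: cvgV; [exact: lt0r_neq0 | exact: cvg_id].
Qed.

(** [major] is the derivative of [x^rho P x / rho].  It dominates the source term,
    which may be singular at 0 when [rho + b < 1], and bounds its integral. *)
Let major x : R := n x + x `^ rho * p x / rho.

Let major_prop u : 0 < u ->
  mu.-integrable `[0, u] (EFin \o major) /\
  \int[mu]_(y in `[0, u]) major y = u `^ rho * P u / rho.
Proof.
move=> u0.
have dM x : 0 < x -> is_derive x 1 (fun x => x `^ rho * P x * rho^-1) (major x).
  move=> x0; apply: (is_derive_eq (is_deriveM (is_derive_weight x0) (is_derive_cst rho^-1 x 1))).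
  by rewrite /major /GRing.scale/= mulr0 add0r; field; rewrite !lt0r_neq0.
have cM x : 0 < x -> {for x, continuous major}.
  move=> x0; apply: cvgD; first exact: continuous_source.
  apply: cvgM; last exact: cvg_cst.
  apply: cvgM; last exact: continuous_tailed_density.
  exact: is_derive_continuous (is_derive_powR rho x0).
have M0 x : 0 < x -> 0 <= major x.
  move=> /ltW x0; rewrite addr_ge0 ?source_ge0// divr_ge0 ?(ltW rho0)//.
  exact: mulr_ge0 (powR_ge0 _ _) (tailed_density_ge0 k0 b0 x0).
have lim0 : x `^ rho * P x * rho^-1 @[x --> 0^'+] --> (0 : R).
  rewrite -[X in _ --> X](mul0r rho^-1); apply: cvgM; last exact: cvg_cst.
  by rewrite -[X in _ --> X](mul0r 0); apply: cvgM; [exact: powR_cvg0 | exact: tailed_cdf_cvg0].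
have intM := FTC_improper_segment u0 dM cM M0 lim0.
split; last by rewrite /Rintegral intM.
exact: (integrable_ge0_fin cM M0 intM).
Qed.

Let source_le_major x : 0 <= x -> n x <= major x.
Proof.
move=> x0; rewrite lerDl divr_ge0 ?(ltW rho0)//.
exact: mulr_ge0 (powR_ge0 _ _) (tailed_density_ge0 k0 b0 x0).
Qed.

Let integrable_source u : mu.-integrable `[0, u] (EFin \o n).
Proof.
have u0 : 0 < `|u| + 1 by rewrite ltr_wpDl.
have [intM _] := major_prop u0.
apply: (@integrableS _ _ _ mu `[0, `|u| + 1]) => //.
  by apply: subset_itvl; rewrite bnd_simp (le_trans (ler_norm u))// lerDl.
apply: integrable_dominated intM => //.
  by apply: measurable_fun_half_line; exact: continuous_source.
move=> x; rewrite /= in_itv/= => /andP[x0 _].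
by rewrite ger0_norm ?source_le_major ?source_ge0.
Qed.

Let num_ge0 x : 0 <= N x.
Proof. by apply: Rintegral_ge0 => y /=; rewrite in_itv/= => /andP[y0 _]; exact: source_ge0. Qed.

Let num_le x : 0 < x -> N x <= x `^ rho * P x / rho.
Proof.
move=> x0; have [intM <-] := major_prop x0.
apply: le_Rintegral => // y /=; rewrite in_itv/= => /andP[y0 _].
exact: source_le_major.
Qed.

(** The numerator is at most [x^rho P x / rho], and [rho gamma = r]. *)
Lemma marginal_value_bounds x : 0 <= x -> 0 <= w x <= r^-1.
Proof.
rewrite le_eqVlt => /predU1P[<-|x0].
  (* the denominator is 0 there, and so is the quotient by convention *)
  by rewrite /w powR0 ?lt0r_neq0// mul0r mulr0 invr0 mulr0 lexx invr_ge0 ltW.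
have W0 := weight_gt0 x0; have g0 := mulr_gt0 gamma0 W0.
rewrite divr_ge0 ?num_ge0 ?(ltW g0)//= ler_pdivrMr//.
apply: le_trans (num_le x0) _; rewrite le_eqVlt; apply/orP; left; apply/eqP.
by field; rewrite !lt0r_neq0.
Qed.

(** This is the differentiated value equation
    [gamma x v'' + (r + a T) v' = 1]. *)
Lemma is_derive_marginal_value x : 0 < x ->
  is_derive x 1 w ((1 - (r + a * (1 - P x)) * w x) / (gamma * x)).
Proof.
move=> x0; have W0 := weight_gt0 x0; have g0 := mulr_gt0 gamma0 W0.
have dN : is_derive x 1 N (n x).
  by apply: is_derive_integral_head => //; exact: continuous_source.
have dg := @is_deriveV R (fun x => gamma * (x `^ rho * P x)) x _ 1 (lt0r_neq0 g0)
  (is_deriveM (is_derive_cst gamma x 1) (is_derive_weight x0)).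
apply: (is_derive_eq (is_deriveM dN dg)).
have P0 := tailed_cdf_gt0 b k0 x0; have X0 := powR_gt0 rho x0.
rewrite !fctE /GRing.scale/= /w /n /tailed_density.
by field; rewrite !lt0r_neq0.
Qed.

Let continuous_marginal x : 0 < x -> {for x, continuous w}.
Proof. by move=> x0; exact: is_derive_continuous (is_derive_marginal_value x0). Qed.

Let integrable_marginal u : mu.-integrable `[0, u] (EFin \o w).
Proof.
apply: (@integrable_bounded _ _ _ r^-1) => // x x0.
by have /andP[w0 w1] := marginal_value_bounds x0; rewrite ger0_norm.
Qed.

Lemma is_derive_value_increment x : 0 < x -> is_derive x 1 V (w x).
Proof. by move=> x0; apply: is_derive_integral_head => //; exact: continuous_marginal. Qed.

Lemma value_increment_bounds x : 0 <= x -> 0 <= V x <= x / r.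
Proof.
move=> x0; apply/andP; split.
  apply: Rintegral_ge0 => y /=; rewrite in_itv/= => /andP[y0 _].
  by have /andP[] := marginal_value_bounds y0.
have -> : x / r = \int[mu]_(y in `[0, x]) r^-1.
  have len : lebesgue_measure (`[0, x]%classic : set R) = x%:E.
    rewrite lebesgue_measure_itv/= lte_fin; case: ltP => [_|xle0].
      by rewrite -EFinB subr0.
    by congr EFin; apply/eqP; rewrite eq_le x0 xle0.
  by rewrite Rintegral_cst// [X in fine X](len) mulrC.
apply: le_Rintegral => //.
  apply: (@integrable_bounded _ (fun=> r^-1) _ r^-1) => [y y0|y y0]; first exact: cvg_cst.
  by rewrite ger0_norm// invr_ge0 ltW.
by move=> y /=; rewrite in_itv/= => /andP[y0 _]; have /andP[] := marginal_value_bounds y0.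
Qed.

Section integrable_tail_income.
Hypotheses (theta1 : theta < 1) (r_neq : r != gamma).

Let b1 : 1 < b. Proof. by rewrite invf_gt1. Qed.

Let continuous_increment x : 0 < x -> {for x, continuous V}.
Proof. by move=> x0; exact: is_derive_continuous (is_derive_value_increment x0). Qed.

Let increment0 : V 0 = 0.
Proof.
have := value_increment_bounds (lexx 0); rewrite mul0r => /andP[V0 V1].
by apply/eqP; rewrite eq_le V0 V1.
Qed.

Lemma integrable_increment_diff x : 0 <= x ->
  mu.-integrable `[x, +oo[ (EFin \o (fun y => (V y - V x) * p y)).
Proof.
move=> x0.
have sub_x : `[x, +oo[ `<=` Rplus R by apply: subset_itvr; rewrite bnd_simp.
have mf : measurable_fun `[x, +oo[ (fun y => (V y - V x) * p y).
  have mf0 : measurable_fun (Rplus R) (fun y => (V y - V x) * p y).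
    apply: measurable_fun_half_line => y y0; apply: cvgM; last exact: continuous_tailed_density.
    by apply: cvgB; [exact: continuous_increment | exact: cvg_cst].
  exact: measurable_funS mf0.
have intyp : mu.-integrable `[x, +oo[ (EFin \o (fun y => y * p y)).
  by apply: integrableS (integrable_first_moment k0 b1).
apply: integrable_dominated (integrable_scale r^-1 _ intyp) => //.
move=> y /=; rewrite in_itv/= andbT => xy; have y0 := le_trans x0 xy.
have p0 := tailed_density_ge0 k0 b0 y0.
have /andP[Vx0 Vx] := value_increment_bounds x0.
have /andP[Vy0 Vy] := value_increment_bounds y0.
have xyr : x / r <= y / r by rewrite ler_pM2r ?invr_gt0.
rewrite normrM (ger0_norm p0) mulrA ler_wpM2r// mulrC ler_norml.
by apply/andP; split; lra.
Qed.

(** The difference consists of the integral of [V p] over [0, x] and of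
    [V x T x]; both lie between 0 and [x / r] because [V y <= y / r]. *)
Let gain0_diff x : 0 < x ->
  `|learning_gain p V x - learning_gain p V 0| <= 2 * (x / r).
Proof.
have abs_diff_le (c h t e : R) : 0 <= h <= c -> 0 <= e <= c -> `|t - e - (h + t)| <= 2 * c.
  by move=> /andP[? ?] /andP[? ?]; rewrite ler_norml; apply/andP; split; lra.
move=> x0; have int0 := integrable_increment_diff (lexx 0).
have intp := integrable_tailed_density k0 b0.
have sub_x : `[x, +oo[ `<=` Rplus R by apply: subset_itvr; rewrite bnd_simp ltW.
have intpx : mu.-integrable `[x, +oo[ (EFin \o p) by exact: integrableS intp.
have /andP[Vx0 Vx] := value_increment_bounds (ltW x0).
have P0 := tailed_cdf_ge0 b k0 x; have P1 := tailed_cdf_lt1 b k0 x.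
have xr0 := le_trans Vx0 Vx.
have VT : V x * (1 - P x) <= x / r by apply: le_trans Vx; rewrite ler_piMr//; lra.
have VT0 : 0 <= V x * (1 - P x) by rewrite mulr_ge0// ltW.
have xP : x / r * P x <= x / r by rewrite ler_piMr//; lra.
have gainx : learning_gain p V x =
    \int[mu]_(y in `[x, +oo[) ((V y - V 0) * p y) - V x * (1 - P x).
  rewrite -(tail_mass_tailed_density k0 b0 x0) /tail_mass -RintegralZl//.
  rewrite -RintegralB//; [|exact: integrableS int0|exact: integrable_scale].
  by apply: eq_Rintegral => y _; rewrite increment0; ring.
have split0 := integral_head_tail (ltW x0) int0.
have head_ge0 : 0 <= \int[mu]_(y in `[0, x]) ((V y - V 0) * p y).
  apply: Rintegral_ge0 => y /=; rewrite in_itv/= => /andP[y0 _].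
  rewrite increment0 subr0 mulr_ge0 ?tailed_density_ge0//.
  by have /andP[] := value_increment_bounds y0.
have sub_0x : `[0, x] `<=` Rplus R by exact: subset_itvl.
have intp0 : mu.-integrable `[0, x] (EFin \o p) by exact: integrableS intp.
have head_le : \int[mu]_(y in `[0, x]) ((V y - V 0) * p y) <= x / r * P x.
  rewrite -(distribution_tailed_density k0 b0 x0) -RintegralZl//.
  apply: le_Rintegral => //; [exact: integrableS int0|exact: integrable_scale|].
  move=> y /=; rewrite in_itv/= => /andP[y0 yx].
  rewrite increment0 subr0 ler_wpM2r ?tailed_density_ge0//.
  have /andP[_ Vy] := value_increment_bounds y0.
  by apply: le_trans Vy _; rewrite ler_pM2r ?invr_gt0.
have gain00 : learning_gain p V 0 = \int[mu]_(y in Rplus R) ((V y - V 0) * p y) by [].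
rewrite gainx gain00 -split0; apply: abs_diff_le; rewrite ?VT0 ?head_ge0//=.
exact: le_trans head_le xP.
Qed.

(** The value imposed by the value equation at 0, where the income and the term
    in [v'] vanish. *)
Definition value_at_0 : R := a * learning_gain p V 0 / (r - gamma).

Definition bgp_value_fun x : R := value_at_0 + V x.
Local Notation v := bgp_value_fun.

Let v0E : (r - gamma) * value_at_0 = a * learning_gain p V 0.
Proof. by rewrite /value_at_0 mulrC divfK// subr_eq0. Qed.

Let gain_v x : learning_gain p v x = learning_gain p V x.
Proof. by apply: eq_Rintegral => y _; rewrite /v; ring. Qed.

Let is_derive_v x : 0 < x -> is_derive x 1 v (w x).
Proof.
move=> x0; have dV := is_derive_value_increment x0.
apply: (is_derive_eq (is_deriveD (is_derive_cst value_at_0 x 1) dV)).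
by rewrite add0r.
Qed.

Let is_derive_gain x : 0 < x ->
  is_derive x 1 (learning_gain p V) (- (w x * (1 - P x))).
Proof.
move=> x0; have dV := is_derive_value_increment x0.
rewrite -(tail_mass_tailed_density k0 b0 x0) -(is_derive1E dV).
apply: is_derive_learning_gain => //.
- exact: integrable_tailed_density.
- exact: continuous_tailed_density.
- exact: integrable_increment_diff.
Qed.

Let residual x : R :=
  x + a * learning_gain p V x - (r - gamma) * v x - gamma * (x * w x).

Let residual_cst x y : 0 < x -> 0 < y -> residual x = residual y.
Proof.
move=> x0 y0; apply: derive0_const => // t t0.
have dw := is_derive_marginal_value t0.
have dl := is_deriveD (is_derive_id t 1) (is_deriveM (is_derive_cst a t 1) (is_derive_gain t0)).
have dm := is_deriveM (is_derive_cst (r - gamma) t 1) (is_derive_v t0).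
have dr := is_deriveM (is_derive_cst gamma t 1) (is_deriveM (is_derive_id t 1) dw).
apply: (is_derive_eq (is_deriveB (is_deriveB dl dm) dr)).
by rewrite !fctE /GRing.scale/=; field; rewrite !lt0r_neq0.
Qed.

(** The residual is constant on the positive half-line and bounded by [K x], so
    it vanishes. *)
Let residual0 x : 0 < x -> residual x = 0.
Proof.
(* [K x] adds up [x], the bound [2 x / r] on the variation of the gain, [V x <= x / r]
   and [w x <= 1 / r]. *)
move=> x0; pose K := 1 + (2 * a + `|r - gamma| + gamma) / r.
have K0 : 0 < K.
  by rewrite ltr_pwDl// divr_ge0 ?(ltW r0)// !addr_ge0 ?mulr_ge0 ?(ltW a0) ?(ltW theta0).
have bound y : 0 < y -> `|residual y| <= K * y.
  move=> y0; have /andP[Vy0 Vy] := value_increment_bounds (ltW y0).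
  have /andP[wy0 wy] := marginal_value_bounds (ltW y0).
  have -> : residual y = y + a * (learning_gain p V y - learning_gain p V 0)
      - (r - gamma) * V y - gamma * (y * w y).
    by rewrite mulrBr -v0E /residual /v; ring.
  have -> : K * y = y + a * (2 * (y / r)) + `|r - gamma| * (y / r) + gamma * (y / r).
    by rewrite /K; ring.
  apply: (le_trans (ler_normB _ _)); apply: lerD.
  - apply: (le_trans (ler_normB _ _)); apply: lerD; last first.
      by rewrite normrM (ger0_norm Vy0) ler_wpM2l.
    apply: (le_trans (ler_normD _ _)); apply: lerD; first by rewrite ger0_norm// ltW.
    by rewrite normrM (gtr0_norm a0) ler_pM2l// gain0_diff.
  - rewrite ger0_norm; first by rewrite ler_pM2l// ler_pM2l.
    exact: mulr_ge0 (ltW gamma0) (mulr_ge0 (ltW y0) wy0).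
apply/eqP; rewrite -normr_le0 leNgt; apply/negP => h0.
have y0 : 0 < `|residual x| / (2 * K) by rewrite divr_gt0// mulr_gt0.
have := bound _ y0; rewrite -(residual_cst x0 y0).
have -> : K * (`|residual x| / (2 * K)) = `|residual x| / 2 by field; exact: lt0r_neq0.
lra.
Qed.

Theorem bgp_value_fun_is_bgp :
  is_bgp (fun=> a) f0 k theta r gamma p v (fun=> 0).
Proof.
split.
- by move=> x _; rewrite lexx ler01.
- exact: tailed_density_is_bgp.
split.
- apply/continuous_within_itvcyP; split.
    by move=> x; rewrite in_itv/= andbT => x0; exact: is_derive_continuous (is_derive_v x0).
  rewrite /v increment0; apply: cvgD; first exact: cvg_cst.
  apply: (@squeeze_cvgr _ _ _ _ (fun=> 0) (fun x => x / r)).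
  + near=> x; apply: value_increment_bounds.
    by near: x; exact: nbhs_right_ge.
  + exact: cvg_cst.
  + rewrite -[X in _ --> X](mul0r r^-1); apply: cvgM; last exact: cvg_cst.
    exact/cvg_at_right_filter/cvg_id.
- by move=> x x0; have := is_derive_v x0.
- move=> x x0; have := integrable_increment_diff x0.
  by congr (mu.-integrable _ _); apply/funext => y /=; congr EFin; rewrite /v; ring.
- move=> x tau x0 /(_ x x0)/andP[tau0 _]; rewrite /payoff lerD2r ler_wpM2r//.
  by lra.
- move=> x x0; rewrite /payoff -/(learning_gain p v x) subr0 mul1r gain_v.
  move: x0; rewrite le_eqVlt => /predU1P[<-|x0].
    by rewrite mulr0 addr0 add0r /v increment0 addr0 v0E.
  rewrite (is_derive1E (is_derive_v x0)).
  by have := residual0 x0; rewrite /residual; lra.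
Unshelve. all: by end_near. Qed.

End integrable_tail_income.
End value_construction.

(** * Balanced growth paths *)

Theorem theorem4p3 (R : realType) (f0 : R -> R) (k theta r alpha0 : R)
  (hf0 : is_probability_density f0)
  (hk : 0 < k) (htheta : 0 < theta)
  (htail : (1 - distribution_function f0 z) / z `^ (- theta^-1) @[z --> +oo] --> k)
  (hr : 0 < r) (halpha0 : 0 < alpha0) :
  let alpha : R -> R := fun=> alpha0 in
  let gamma0 := alpha0 * theta * \int[lebesgue_measure]_(z in Rplus R) f0 z in
  [/\ (exists phi : R -> R,
         bgp_density alpha f0 k theta gamma0 phi (fun=> 0) /\
         (theta < 1 -> r != gamma0 ->
          exists v : R -> R,
            is_bgp alpha f0 k theta r gamma0 phi v (fun=> 0))),
      (forall (gamma : R) (phi sigma : R -> R),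
         admissible sigma -> bgp_density alpha f0 k theta gamma phi sigma ->
         gamma = gamma0 /\
         (forall x, 0 < x -> distribution_function phi x = 1 / (1 + k * x `^ (- theta^-1)))),
      (forall (gamma : R) (phi v sigma : R -> R),
         is_bgp alpha f0 k theta r gamma phi v sigma ->
         forall x, 0 < x -> sigma x = 0) &
      (forall (gamma1 gamma2 : R) (phi1 phi2 v1 v2 sigma1 sigma2 : R -> R),
         is_bgp alpha f0 k theta r gamma1 phi1 v1 sigma1 ->
         is_bgp alpha f0 k theta r gamma2 phi2 v2 sigma2 ->
         forall x, 0 <= x -> v1 x = v2 x)].
Proof.
case: hf0 => _ _ f0_mass alpha gamma0.
rewrite {}/gamma0 f0_mass mulr1 {}/alpha.
have density_unique gamma phi sigma
    (bgp_phi : bgp_density (fun=> alpha0) f0 k theta gamma phi sigma) :=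
  stationary_density_unique f0_mass hk htheta halpha0 bgp_phi.
have with_rate gamma phi v sigma :
    is_bgp (fun=> alpha0) f0 k theta r gamma phi v sigma ->
    is_bgp (fun=> alpha0) f0 k theta r (alpha0 * theta) phi v sigma.
  by move=> bgp; case: (bgp) => _ /density_unique[<- _ _] _.
split.
- exists (tailed_density k theta^-1); split; first exact: tailed_density_is_bgp.
  move=> theta1 r_neq; exists (bgp_value_fun k theta alpha0 r).
  exact: bgp_value_fun_is_bgp.
- move=> gamma phi sigma _ bgp_phi.
  have [gammaE tailE _] := density_unique _ _ _ bgp_phi; split=> // x x0.
  rewrite (distribution_tail f0_mass bgp_phi) ?(ltW x0)// tailE// subKr.
  by rewrite tailed_cdfE.
- by move=> gamma phi v sigma /with_rate bgp x x0; exact: (bgp_control0 bgp x0).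
- move=> gamma1 gamma2 phi1 phi2 v1 v2 sigma1 sigma2 /with_rate bgp1 /with_rate bgp2.
  exact: (bgp_value_unique f0_mass hk htheta halpha0 bgp1 bgp2).
Qed.
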